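(* Let $A$ be a finite dimensional associative algebra over a field $\Bbbk$, with simple modules $L_\lambda$ indexed by $\lambda\in\Lambda$ (up to isomorphism), and let $\prec^1$ and $\prec^2$ be two partial orders on $\Lambda$ such that both $(A,\prec^1)$ and $(A,\prec^2)$ are standardly stratified. Assume that the category $A\text{-}\mathrm{mod}$ has a simple preserving duality. Then the corresponding essential orders coincide: $\prec^1_e=\prec^2_e$.
   Context: $A\text{-}\mathrm{mod}$ is the category of finite dimensional left $A$-modules, and $\{L_\lambda:\lambda\in\Lambda\}$ is a complete irredundant list of representatives of isomorphism classes of simple $A$-modules. $P_\lambda$ and $I_\lambda$ denote the indecomposable projective cover and the indecomposable injective envelope of $L_\lambda$. The trace of $M$ in $N$ is the submodule of $N$ spanned by the images of all homomorphisms $M\to N$. Fix a partial order $\prec$ on $\Lambda$ (with reflexive version $\preceq$). Standard module: $\Delta_\lambda$ is the quotient of $P_\lambda$ by the trace in $P_\lambda$ of all $P_\mu$ with $\mu\not\preceq\lambda$. Costandard module: $\nabla_\lambda$ is the intersection of the kernels of all morphisms $I_\lambda\to I_\mu$ with $\mu\not\preceq\lambda$. Proper costandard module: $\overline\nabla_\lambda$ is the maximal submodule of $\nabla_\lambda$ with $[\overline\nabla_\lambda:L_\lambda]=1$. $(A,\prec)$ is standardly stratified if, for each $\lambda\in\Lambda$, the kernel of the surjection $P_\lambda\to\Delta_\lambda$ has a filtration each subquotient of which is isomorphic to $\Delta_\mu$ for some $\mu$ with $\lambda\prec\mu$. Essential order: for a standardly stratified $(A,\prec)$, $\prec_e$ is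 the minimal partial order on $\Lambda$ containing all pairs $(\lambda,\mu)$ such that $L_\lambda$ is a composition subquotient of $\Delta_\mu$ or $L_\lambda$ is a composition subquotient of $\overline\nabla_\mu$ (pairs $(\lambda,\mu)$ meaning $\lambda$ below $\mu$). A simple preserving duality is a contravariant self-equivalence $\star$ of $A\text{-}\mathrm{mod}$ which preserves the isomorphism classes of simple modules. *)

(* Defs.v *)
From HB Require Import structures.
From mathcomp Require Import all_boot all_order all_algebra all_field.
From mathcomp Require Import boolp.

Set Implicit Arguments.
Unset Strict Implicit.
Unset Printing Implicit Defensive.

Import GRing.Theory.
Local Open Scope ring_scope.

(* A finite dimensional left A-module is a finite dimensional K-space V with a unital K-algebra morphism
   from A to the endomorphisms of V. *)
Record fdmod (K : fieldType) (A : falgType K) := FdMod {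
  carrier :> vectType K;
  act : A -> 'End(carrier);
  act_linear : linear act;
  act1 : act 1 = \1%VF;
  actM : forall a b, act (a * b) = (act a \o act b)%VF
}.
Arguments act {K A} M a : rename.

HB.instance Definition _ (K : fieldType) (A : falgType K) (M : fdmod A) :=
  GRing.isLinear.Build K A 'End(M) _ (act M) (@act_linear K A M).

Definition is_hom (K : fieldType) (A : falgType K) (M N : fdmod A)
    (f : 'Hom(M, N)) : Prop :=
  forall a v, f (act M a v) = act N a (f v).

Definition mod_iso (K : fieldType) (A : falgType K) (M N : fdmod A) : Prop :=
  exists2 f : 'Hom(M, N), is_hom f & bijective f.

Record submodule (K : fieldType) (A : falgType K) (M : fdmod A) := Submodule {
  subm :> {vspace M};
  submP : forall a v, v \in subm -> act M a v \in subm
}.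

Section Submodules.
Variables (K : fieldType) (A : falgType K).

Lemma zero_subm_proof (M : fdmod A) a v : v \in (0%VS : {vspace M}) ->
  act M a v \in (0%VS : {vspace M}).
Proof. by rewrite !memv0 => /eqP->; rewrite linear0. Qed.

Definition zero_subm (M : fdmod A) : submodule M :=
  Submodule (@zero_subm_proof M).

Lemma full_subm_proof (M : fdmod A) a v : v \in ({:M}%VS : {vspace M}) ->
  act M a v \in ({:M}%VS : {vspace M}).
Proof. by rewrite !memvf. Qed.

Definition full_subm (M : fdmod A) : submodule M :=
  Submodule (@full_subm_proof M).

(* The subquotient V / U of M is realised on the complement V :\: U of U in V
   chosen by the library; [subquot_proj] is the canonical projection, see
   [subquot_projP] below.  (If U is not contained in V, this is (V + U) / U.) *)
Definition subquot_proj (M : fdmod A) (V U : submodule M) :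
    'Hom(M, subvs_of (V :\: U)%VS) :=
  (linfun (vsproj (V :\: U)%VS) \o addv_pi1 V U)%VF.

Definition subquot_act (M : fdmod A) (V U : submodule M) (a : A) :
    'End(subvs_of (V :\: U)%VS) :=
  (subquot_proj V U \o act M a \o linfun vsval)%VF.

Lemma subquot_projE (M : fdmod A) (V U : submodule M) v :
  vsval (subquot_proj V U v) = addv_pi1 V U v.
Proof. by rewrite comp_lfunE lfunE /= vsprojK // memv_pi. Qed.

Lemma subquot_proj_id (M : fdmod A) (V U : submodule M) x :
  subquot_proj V U (vsval x) = x.
Proof.
apply: val_inj; rewrite /= subquot_projE /addv_pi1 daddv_pi_id ?subvsP //.
exact: capv_diff.
Qed.

Lemma subquot_proj_sub (M : fdmod A) (V U : submodule M) v : v \in V ->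
  v - vsval (subquot_proj V U v) \in (U : {vspace M}).
Proof.
move=> Vv; rewrite subquot_projE.
have {1}<- := @addv_pi1_pi2 _ _ V U v (subvP (addvSl _ _) v Vv).
by rewrite addrC addKr memv_pi2.
Qed.

Lemma subquot_proj_ker (M : fdmod A) (V U : submodule M) u : u \in U ->
  subquot_proj V U u = 0.
Proof.
move=> Uu; apply: val_inj; rewrite /= subquot_projE /addv_pi1.
have dUV := capv_diff V U.
have := daddv_pi_add dUV (subvP (addvSr (V :\: U) U) u Uu).
rewrite (@daddv_pi_id _ _ U) // ?[(U :&: _)%VS]capvC //.
by move/(canRL (addrK _)); rewrite subrr.
Qed.

Lemma subquot_actE (M : fdmod A) (V U : submodule M) a x :
  subquot_act V U a x = subquot_proj V U (act M a (vsval x)).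
Proof. by rewrite /subquot_act comp_lfunE [linfun vsval x]lfunE comp_lfunE. Qed.

Lemma subquot_act_proj (M : fdmod A) (V U : submodule M) a v : v \in V ->
  subquot_proj V U (act M a v) = subquot_act V U a (subquot_proj V U v).
Proof.
move=> Vv; rewrite subquot_actE.
apply/eqP; rewrite -subr_eq0 -(raddfB (subquot_proj V U)) -raddfB; apply/eqP.
by apply: subquot_proj_ker; apply: submP; apply: subquot_proj_sub.
Qed.

Lemma subquot_act_linear (M : fdmod A) (V U : submodule M) :
  linear (subquot_act V U).
Proof.
move=> k a b; rewrite /subquot_act act_linear.
by rewrite comp_lfunDr -comp_lfunZr comp_lfunDl -comp_lfunZl.
Qed.

Lemma subquot_act1 (M : fdmod A) (V U : submodule M) :
  subquot_act V U 1 = \1%VF.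
Proof.
by apply/lfunP=> x; rewrite subquot_actE act1 !id_lfunE subquot_proj_id.
Qed.

Lemma subquot_actM (M : fdmod A) (V U : submodule M) a b :
  subquot_act V U (a * b) = (subquot_act V U a \o subquot_act V U b)%VF.
Proof.
apply/lfunP=> x; rewrite [RHS]comp_lfunE.
have Vx : vsval x \in V by apply: subvP (diffvSl _ _) _ (subvsP x).
rewrite (subquot_actE b x) -subquot_act_proj ?submP //.
by rewrite subquot_actE actM comp_lfunE.
Qed.

Definition subquot (M : fdmod A) (V U : submodule M) : fdmod A :=
  FdMod (@subquot_act_linear M V U) (subquot_act1 V U) (@subquot_actM M V U).

Lemma subquot_projP (M : fdmod A) (V U : submodule M) :
  [/\ forall a v, v \in V ->
        subquot_proj V U (act M a v) = act (subquot V U) a (subquot_proj V U v),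
      (subquot_proj V U @: V)%VS = fullv
    & (V :&: lker (subquot_proj V U) = V :&: U)%VS].
Proof.
split; first exact: subquot_act_proj.
  apply/vspaceP=> x; rewrite memvf; apply/memv_imgP; exists (vsval x).
    exact: subvP (diffvSl _ _) _ (subvsP x).
  by rewrite subquot_proj_id.
apply/vspaceP=> v; rewrite !memv_cap memv_ker; case Vv: (v \in _) => //=.
apply/eqP/idP=> [v0|]; last exact: subquot_proj_ker.
by have := @subquot_proj_sub M V U v Vv; rewrite v0 [X in v - X](_ : _ = 0) ?subr0.
Qed.

Definition submod (M : fdmod A) (U : submodule M) : fdmod A :=
  subquot U (zero_subm M).

Definition quomod (M : fdmod A) (U : submodule M) : fdmod A :=
  subquot (full_subm M) U.

(* [:: U_1; ...; U_n] encodes the filtration 0 <= U_1 <= ... <= U_n = M. *)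
Definition is_filtration (M : fdmod A) (s : seq (submodule M)) : Prop :=
  path (fun U V : submodule M => (U <= V)%VS) (zero_subm M) s
  /\ (last (zero_subm M) s = fullv :> {vspace M}).

Definition subquotients (M : fdmod A) (s : seq (submodule M)) :
    seq (fdmod A) :=
  pairmap (fun U V => subquot V U) (zero_subm M) s.

Definition simple_mod (M : fdmod A) : Prop :=
  ({:M} <> 0)%VS
  /\ forall U : submodule M, (U = 0 :> {vspace M})%VS \/ U = fullv :> {vspace M}.

Definition composition_series (M : fdmod A) (s : seq (submodule M)) : Prop :=
  is_filtration s /\ all (fun X => `[< simple_mod X >]) (subquotients s).

(* [M : L] = n; by Jordan-Hoelder any composition series yields the same n. *)
Definition has_mult (M L : fdmod A) (n : nat) : Prop :=
  exists2 s : seq (submodule M), composition_series s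
    & count (fun X => `[< mod_iso X L >]) (subquotients s) = n.

Definition comp_factor (M L : fdmod A) : Prop :=
  exists2 s : seq (submodule M), composition_series s
    & has (fun X => `[< mod_iso X L >]) (subquotients s).

End Submodules.

Section Covers.
Variables (K : fieldType) (A : falgType K).

Definition projective_mod (P : fdmod A) : Prop :=
  forall (M N : fdmod A) (g : 'Hom(M, N)) (f : 'Hom(P, N)),
    is_hom g -> limg g = fullv -> is_hom f ->
  exists2 h : 'Hom(P, M), is_hom h & (g \o h)%VF = f.

Definition injective_mod (I : fdmod A) : Prop :=
  forall (M N : fdmod A) (g : 'Hom(M, N)) (f : 'Hom(M, I)),
    is_hom g -> lker g = 0%VS -> is_hom f ->
  exists2 h : 'Hom(N, I), is_hom h & (h \o g)%VF = f.

Definition projective_cover (P L : fdmod A) : Prop :=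
  projective_mod P /\ exists p : 'Hom(P, L),
    [/\ is_hom p, limg p = fullv
      & forall U : submodule P,
          (U + lker p)%VS = fullv -> U = fullv :> {vspace P}].

Definition injective_envelope (I L : fdmod A) : Prop :=
  injective_mod I /\ exists i : 'Hom(L, I),
    [/\ is_hom i, lker i = 0%VS
      & forall U : submodule I,
          (U :&: limg i = 0)%VS -> (U = 0 :> {vspace I})%VS].

Definition hom_defect (M N : fdmod A) (a : A) (f : 'Hom(M, N)) : 'Hom(M, N) :=
  (f \o act M a)%VF - (act N a \o f)%VF.

Lemma hom_defect_linear (M N : fdmod A) a : linear (@hom_defect M N a).
Proof.
move=> k f g; rewrite /hom_defect comp_lfunDl comp_lfunDr.
by rewrite -comp_lfunZl -comp_lfunZr opprD addrACA scalerBr.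
Qed.

HB.instance Definition _ (M N : fdmod A) a :=
  GRing.isLinear.Build K 'Hom(M, N) 'Hom(M, N) _ (@hom_defect M N a)
    (@hom_defect_linear M N a).

(* The space of A-homomorphisms from M to N, see [homvP]. *)
Definition homv (M N : fdmod A) : {vspace 'Hom(M, N)} :=
  (\bigcap_(a <- vbasis {:A}) lker (linfun (@hom_defect M N a)))%VS.

Lemma homvP (M N : fdmod A) (f : 'Hom(M, N)) :
  reflect (is_hom f) (f \in homv M N).
Proof.
have E a : (f \in lker (linfun (@hom_defect M N a)))
  = ((f \o act M a)%VF == (act N a \o f)%VF).
  by rewrite memv_ker lfunE /= subr_eq0.
apply: (iffP idP) => [|homf].
  rewrite /homv big_tnth memvE => /subv_bigcapP fh a v.
  have {}fh i : (f \o act M (vbasis {:A})`_i)%VF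
              = (act N (vbasis {:A})`_i \o f)%VF :> 'Hom(M, N).
    case: (ltnP i (size (vbasis {:A}))) => [lti|gei].
      have /= := fh (Ordinal lti) isT.
      by rewrite -memvE E (tnth_nth 0) /= => /eqP.
    rewrite nth_default //.
    by rewrite !linear0 comp_lfun0r comp_lfun0l.
  rewrite (coord_vbasis (memvf a)) !linear_sum !sum_lfunE linear_sum.
  apply: eq_bigr => i _; rewrite !linearZ !scale_lfunE linearZ; congr (_ *: _).
  by have /lfunP/(_ v) := fh i; rewrite !comp_lfunE.
rewrite /homv big_tnth memvE; apply/subv_bigcapP => i _; rewrite -memvE E.
by apply/eqP/lfunP=> v; rewrite !comp_lfunE homf.
Qed.

(* The span in N of the images of all homomorphisms to N from the modules Q j,
   S j; the images of a basis of each Hom space suffice, see [traceP]. *)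
Definition trace_space (J : finType) (S : pred J) (Q : J -> fdmod A)
    (N : fdmod A) : {vspace N} :=
  (\sum_(j | S j) \sum_(f <- vbasis (homv (Q j) N)) limg f)%VS.

Lemma traceP (J : finType) (S : pred J) (Q : J -> fdmod A) (N : fdmod A)
    (W : {vspace N}) :
  (trace_space S Q N <= W)%VS <->
  (forall (j : J) (f : 'Hom(Q j, N)), S j -> is_hom f -> (limg f <= W)%VS).
Proof.
split=> [|sW].
  move=> /subv_sumP sW j f Sj /homvP homf.
  apply/subvP=> _ /memv_imgP[v _ ->].
  rewrite (coord_vbasis homf) sum_lfunE memv_suml // => i _.
  rewrite scale_lfunE memvZ //.
  have := sW j Sj; rewrite big_tnth => /subv_sumP.
  have sz : size (vbasis (homv (Q j) N)) = \dim (homv (Q j) N).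
    exact: size_tuple.
  move=> /(_ (cast_ord (esym sz) i) isT) /subvP; apply.
  by rewrite (tnth_nth 0) /=; apply: memv_img; apply: memvf.
apply/subv_sumP => j Sj; rewrite big_tnth; apply/subv_sumP=> i _.
by apply: sW Sj _; apply/homvP/vbasis_mem/mem_tnth.
Qed.

Lemma trace_proof (J : finType) (S : pred J) (Q : J -> fdmod A) (N : fdmod A)
    a v :
  v \in trace_space S Q N -> act N a v \in trace_space S Q N.
Proof.
move=> tv; suff : (trace_space S Q N <= act N a @^-1: trace_space S Q N)%VS.
  by move/subvP/(_ v tv); rewrite memv_preim.
apply/traceP=> j f Sj homf; apply/subvP=> _ /memv_imgP[w _ ->].
rewrite -memv_preim -homf.
have /traceP sT := subvv (trace_space S Q N).
exact: subvP (sT j f Sj homf) _ (memv_img f (memvf _)).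
Qed.

Definition trace (J : finType) (S : pred J) (Q : J -> fdmod A) (N : fdmod A) :
  submodule N := Submodule (@trace_proof J S Q N).

(* The intersection of the kernels of all homomorphisms from N to the modules
   Q j, S j; see [cotraceP]. *)
Definition cotrace_space (J : finType) (S : pred J) (Q : J -> fdmod A)
    (N : fdmod A) : {vspace N} :=
  (\bigcap_(j | S j) \bigcap_(f <- vbasis (homv N (Q j))) lker f)%VS.

Lemma cotraceP (J : finType) (S : pred J) (Q : J -> fdmod A) (N : fdmod A)
    (v : N) :
  v \in cotrace_space S Q N <->
  (forall (j : J) (f : 'Hom(N, Q j)), S j -> is_hom f -> f v = 0).
Proof.
rewrite memvE; split=> [|v0].
  move=> /subv_bigcapP sv j f Sj /homvP homf.
  rewrite (coord_vbasis homf) sum_lfunE big1 // => i _.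
  rewrite scale_lfunE; have := sv j Sj; rewrite big_tnth => /subv_bigcapP.
  have sz : size (vbasis (homv N (Q j))) = \dim (homv N (Q j)).
    exact: size_tuple.
  move=> /(_ (cast_ord (esym sz) i) isT).
  by rewrite -memvE memv_ker (tnth_nth 0) /= => /eqP->; rewrite scaler0.
apply/subv_bigcapP => j Sj; rewrite big_tnth; apply/subv_bigcapP=> i _.
rewrite -memvE memv_ker; apply/eqP; apply: v0 Sj _.
exact/homvP/vbasis_mem/mem_tnth.
Qed.

Lemma cotrace_proof (J : finType) (S : pred J) (Q : J -> fdmod A)
    (N : fdmod A) a v :
  v \in cotrace_space S Q N -> act N a v \in cotrace_space S Q N.
Proof.
move=> /cotraceP v0; apply/cotraceP => j f Sj homf.
by rewrite homf (v0 j f Sj homf) linear0.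
Qed.

Definition cotrace (J : finType) (S : pred J) (Q : J -> fdmod A)
  (N : fdmod A) : submodule N := Submodule (@cotrace_proof J S Q N).

End Covers.

(* Orders are given by their reflexive versions. *)
Definition partial_order (Lam : finType) (le : rel Lam) : Prop :=
  [/\ reflexive le, antisymmetric le & transitive le].

Section Stratified.
Variables (K : fieldType) (A : falgType K) (Lam : finType).
Variables (L P I : Lam -> fdmod A) (le : rel Lam).

Definition simples_list : Prop :=
  [/\ forall lam, simple_mod (L lam),
      forall lam mu, mod_iso (L lam) (L mu) -> lam = mu
    & forall M : fdmod A, simple_mod M -> exists lam, mod_iso M (L lam)].

(* The trace is the kernel of the surjection from P lam onto standard lam. *)
Definition standard_ker (lam : Lam) : submodule (P lam) :=
  trace (fun mu => ~~ le mu lam) P (P lam).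

Definition standard (lam : Lam) : fdmod A := quomod (standard_ker lam).

Definition costandard (lam : Lam) : fdmod A :=
  submod (cotrace (fun mu => ~~ le mu lam) I (I lam)).

Definition proper_costandard (lam : Lam) (U : submodule (costandard lam)) :
    Prop :=
  has_mult (submod U) (L lam) 1
  /\ forall V : submodule (costandard lam),
       has_mult (submod V) (L lam) 1 -> (U <= V)%VS -> V = U :> {vspace _}.

Definition standardly_stratified : Prop :=
  forall lam, exists2 s : seq (submodule (submod (standard_ker lam))),
    is_filtration s
    & all (fun X => `[< exists mu, [/\ mu != lam, le lam mu
                                     & mod_iso X (standard mu)] >])
          (subquotients s).

Definition essential_pair (lam mu : Lam) : Prop :=
  comp_factor (standard mu) (L lam)
  \/ exists2 U : submodule (costandard mu),
       proper_costandard U & comp_factor (submod U) (L lam).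

(* The least partial order containing all essential pairs, as the intersection
   of all of them. *)
Definition essential_order (lam mu : Lam) : Prop :=
  forall r : rel Lam, partial_order r ->
    (forall x y, essential_pair x y -> r x y) -> r lam mu.

End Stratified.

Section Duality.
Variables (K : fieldType) (A : falgType K).

(* Only the values of [cfmor] on A-homomorphisms are meaningful. *)
Record cofunctor := Cofunctor {
  cfob :> fdmod A -> fdmod A;
  cfmor : forall M N : fdmod A, 'Hom(M, N) -> 'Hom(cfob N, cfob M);
  cfmor_hom : forall (M N : fdmod A) (f : 'Hom(M, N)),
    is_hom f -> is_hom (cfmor f);
  cfmor_id : forall M : fdmod A, cfmor (\1%VF : 'End(M)) = \1%VF;
  cfmor_comp : forall (M N X : fdmod A) (f : 'Hom(M, N)) (g : 'Hom(N, X)),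
    is_hom f -> is_hom g -> cfmor (g \o f)%VF = (cfmor f \o cfmor g)%VF
}.

(* The identity functor is naturally isomorphic to G \o F. *)
Definition quasi_inverse (F G : cofunctor) : Prop :=
  exists eta : forall M : fdmod A, 'Hom(M, G (F M)),
    (forall M, is_hom (eta M) /\ bijective (eta M)) /\
    (forall (M N : fdmod A) (f : 'Hom(M, N)), is_hom f ->
       (cfmor G (cfmor F f) \o eta M)%VF = (eta N \o f)%VF).

Definition is_duality (F : cofunctor) : Prop :=
  exists G : cofunctor, quasi_inverse F G /\ quasi_inverse G F.

Definition simple_preserving (F : cofunctor) : Prop :=
  forall M : fdmod A, simple_mod M -> mod_iso (F M) M.

End Duality.

(* Main.v *)
From HB Require Import structures.
Require Import Defs.
From mathcomp Require Import all_boot all_order all_algebra all_field.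
From mathcomp Require Import fingroup perm boolp zify ring.

(** The essential order is determined by the composition factors of the standard
    modules alone, and these can be read off from the Cartan matrix of the algebra,
    which does not depend on the partial order.

    Multiplicities are measured by the additive functions
    [hdim (P nu) M = \dim Hom(P nu, M)]: such a function is the multiplicity of
    [L nu] in [M], times the dimension of the endomorphism algebra of [L nu]
    ([comp_factorP]).  Let [b] be the table of the [hdim (P nu) (P lam)], [d] the
    table of the [hdim (P nu) (Delta mu)], and [m] the multiplicities of the
    [Delta mu] in a standard filtration of [P lam].

    - Standard filtrations give [b = m d], with [m] unitriangular for the order
      and [d] triangular the other way, with positive diagonal
      ([standard_multiplicities], [standard_le], [standard_top]).
    - The duality [F] makes [b] symmetric ([hdim_cover_sym]).  Indeed [F (P nu)] is
      injective with socle isomorphic to [L nu], so [hdim M (F (P nu))] is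
      [hdim (P nu) M] for all [M]; take [M = P lam] and use that [F] is exact and
      fixes simple modules, so that [F (P nu)] and [P nu] have the same
      composition factors.
    - A symmetric [b] factors as [m x m^T] with [x] diagonal and positive
      ([symmetric_LDU]).  In terms of lattices, the classes of the standard
      modules are an orthogonal basis of the lattice spanned by the classes of
      the projective modules, with form [b].  A positive definite lattice has at
      most one orthogonal basis up to signs and order, and triangularity removes
      this ambiguity ([unitriangular_congruence_unique]).  Hence two orders for
      which the algebra is standardly stratified have the same [m] and [d].
    - Finally the costandard module [Nabla mu] has no composition factor that
      [Delta mu] does not have ([costandard_hdim]), so that the essential pairs
      are those with a nonzero entry in [d] ([essential_pairP]). *)

Set Implicit Arguments.
Unset Strict Implicit.
Unset Printing Implicit Defensive.

Import Order.TTheory GRing.Theory Num.Theory.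
Local Open Scope ring_scope.

(** * Orthogonal bases and unitriangular integer matrices *)

(** The iterates of [s] only move a point upwards, and the last one before the
    orbit closes up is the inverse of [s]; so [s x] is also below [x]. *)
Lemma inflationary_inj_id (T : finType) (le : rel T) (s : T -> T) :
  partial_order le -> injective s -> (forall x, le x (s x)) -> s =1 id.
Proof.
case=> le_refl le_anti le_trans inj_s le_s x.
have le_iter k y : le y (iter k s y).
  by elim: k => [|k IH] //=; apply: le_trans IH _.
apply: le_anti; rewrite le_s andbT.
by rewrite -{2}(finv_f inj_s x); apply: le_iter.
Qed.

Lemma int_le_sqr (z : int) : z <= z ^+ 2.
Proof.
case: (lerP z 0) => [z0|z1]; first exact: le_trans z0 (sqr_ge0 z).
by rewrite expr2 ler_peMr ?(ltW z1).
Qed.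

Section UnitriangularMatrices.

Variables (n : nat).
Implicit Types (le : rel 'I_n) (M D X : 'M[int]_n).

Definition upper le M := forall i j, M i j != 0 -> le i j.

Definition unitriangular le M := upper le M /\ forall i, M i i = 1.

(** In the Leibniz expansion a permutation [s] contributes only if [le i (s i)]
    for all [i], which forces [s] to be the identity. *)
Lemma unitriangular_unit le M :
  partial_order le -> unitriangular le M -> M \in unitmx.
Proof.
move=> po [upM diagM]; rewrite unitmxE (_ : \det M = 1) ?unitr1 //.
rewrite /determinant (bigD1 1%g) //= odd_perm1 expr0 mul1r.
rewrite big1 => [|i _]; last by rewrite perm1 diagM.
rewrite big1 ?addr0 // => s ns.
case: (pickP (fun i => M i (s i) == 0)) => [i /eqP Mi | nz].
  by rewrite (bigD1 i) //= Mi mul0r mulr0.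
case/eqP: ns; apply/permP => i; rewrite perm1.
apply: (inflationary_inj_id po) => [|k]; first exact: perm_inj.
by apply: upM; rewrite nz.
Qed.

(** Back substitution: the entry of [M *m X] at a maximal bad position [(i, j)]
    is [X i j] itself, since the other terms involve entries of [X] at larger bad
    positions, which are zero. *)
Lemma upper_cancel_l le M X :
  partial_order le -> unitriangular le M -> upper le (M *m X) -> upper le X.
Proof.
case=> le_refl le_anti le_trans [upM diagM] upMX i j.
have [m] := ubnP #|[pred k | le i k]|; elim: m i => // m IH i lt_m Xij.
apply: contraT => nij.
have/eqP: (M *m X) i j = 0 by apply: contraNeq nij; apply: upMX.
rewrite mxE (bigD1 i) //= diagM mul1r big1 ?addr0; first by rewrite (negPf Xij).
move=> k nki; apply/eqP; rewrite mulf_eq0 -[_ || _]negbK negb_or.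
apply/negP => /andP[Mik Xkj].
have leik := upM _ _ Mik.
have/IH/(_ Xkj) lekj: (#|[pred k0 | le k k0]| < m)%N.
  rewrite -ltnS (leq_ltn_trans _ lt_m) //.
  apply: proper_card; apply/properP; split.
    by apply/subsetP => z; rewrite !inE; apply: le_trans.
  exists i; rewrite !inE ?le_refl //; apply: contra nki => leki.
  by apply/eqP/le_anti; rewrite leki.
by case/negP: nij; apply: le_trans lekj.
Qed.

(** With [X] the solution of [M *m X = D^T], both [M *m X *m M^T] and its
    transpose are [M *m D], so [X] is symmetric; it is also upper triangular,
    and hence diagonal. *)
Lemma symmetric_LDU le M D :
  partial_order le -> unitriangular le M -> upper le D^T ->
  (M *m D)^T = M *m D ->
  exists2 x : 'rV[int]_n, M *m D = M *m diag_mx x *m M^T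
    & forall i, x 0 i = D i i.
Proof.
move=> po trM upD symMD; have uM := unitriangular_unit po trM.
have [X MX] : exists X, M *m X = D^T.
  by exists (invmx M *m D^T); rewrite mulKVmx.
have upX : upper le X by apply: (upper_cancel_l po trM); rewrite MX.
have MXM : M *m X *m M^T = M *m D by rewrite MX -trmx_mul.
have symX : X^T = X.
  have uMT : M^T \in unitmx by rewrite unitmx_tr.
  apply: (can_inj (mulmxK uMT)); apply: (can_inj (mulKmx uM)).
  by rewrite [RHS]mulmxA MXM -symMD -MXM !trmx_mul !trmxK.
have diagX i j : i != j -> X i j = 0.
  case: po => _ le_anti _ nij; apply/eqP; apply: contraNT nij => nz.
  apply/eqP/le_anti; rewrite upX //= upX //.
  by rewrite -symX mxE.
have eX : X = diag_mx (\row_i X i i).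
  by apply/matrixP => i j; rewrite !mxE; have [->|/diagX->] := eqVneq i j.
exists (\row_i X i i); first by rewrite -eX MXM.
move=> i; have -> : D i i = D^T i i by rewrite mxE.
rewrite -MX !mxE (bigD1 i) //= (proj2 trM) mul1r big1 ?addr0 ?mxE // => j ji.
by rewrite diagX ?mulr0.
Qed.

(** A positive definite integral lattice has, up to order and signs, at most one
    orthogonal basis.  For the form on [int]^n with Gram matrix
    [M1 *m diag_mx x1 *m M1^T], the rows of the inverses of [M1] and [M2] are two
    such bases; triangularity then excludes any permutation and any sign.

    For the first claim, let [q_i] and [b_j] be the vectors of the two bases and
    [Q i j] the coordinates of [q_i] on the [b_j].  If [Q i j != 0], then
    [y = Q i j *: b_j] is orthogonal to [q_i - y].  If [y_k] are the coordinates
    of [y] on the [q_k], this says that [\sum_k x2_k * y_k ^+ 2 = x2_i * y_i].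
    As [y_i <= y_i ^+ 2] for the integer [y_i], all other [y_k] vanish, and [q_i]
    and [b_j] are collinear. *)
Lemma unitriangular_congruence_unique le1 le2 M1 M2 (x1 x2 : 'rV[int]_n) :
  partial_order le1 -> partial_order le2 ->
  unitriangular le1 M1 -> unitriangular le2 M2 ->
  (forall i, 0 < x1 0 i) -> (forall i, 0 < x2 0 i) ->
  M1 *m diag_mx x1 *m M1^T = M2 *m diag_mx x2 *m M2^T -> M1 = M2.
Proof.
move=> po1 po2 tr1 tr2 pos1 pos2 eqB.
have u1 := unitriangular_unit po1 tr1; have u2 := unitriangular_unit po2 tr2.
have [Q M2Q] : exists Q, M2 *m Q = M1.
  by exists (invmx M2 *m M1); rewrite mulKVmx.
have [R M1R] : exists R, M1 *m R = M2.
  by exists (invmx M1 *m M2); rewrite mulKVmx.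
have RQ : R *m Q = 1%:M.
  by apply: (can_inj (mulKmx u1)); rewrite mulmxA M1R M2Q mulmx1.
have QxQ : Q *m diag_mx x1 *m Q^T = diag_mx x2.
  have uM2T : M2^T \in unitmx by rewrite unitmx_tr.
  apply: (can_inj (mulmxK uM2T)); apply: (can_inj (mulKmx u2)).
  by rewrite [RHS]mulmxA -eqB -M2Q trmx_mul !mulmxA.
have RQT : Q^T *m R^T = 1%:M by rewrite -trmx_mul RQ trmx1.
have Qx : Q *m diag_mx x1 = diag_mx x2 *m R^T.
  by rewrite -QxQ -!mulmxA RQT mulmx1.
have RxR : R *m diag_mx x2 *m R^T = diag_mx x1.
  by rewrite -mulmxA -Qx mulmxA RQ mul1mx.
have Qij_x i j : Q i j * x1 0 j = x2 0 i * R j i.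
  have /matrixP/(_ i j) := Qx; rewrite mul_mx_diag mul_diag_mx !mxE.
  by [].
have sumR j : \sum_k R j k * x2 0 k * R j k = x1 0 j.
  have /matrixP/(_ j j) := RxR; rewrite mul_mx_diag !mxE eqxx mulr1n => <-.
  by apply: eq_bigr => k _; rewrite !mxE.
have Rrow i j k : Q i j != 0 -> k != i -> R j k = 0.
  move=> Qij ki; pose y l := Q i j * R j l.
  have Ey : \sum_l x2 0 l * y l ^+ 2 = x2 0 i * y i.
    rewrite /y mulrCA -Qij_x mulrCA -sumR !mulr_sumr.
    by apply: eq_bigr => l _; ring.
  have yk0 : \sum_(l | l != i) x2 0 l * y l ^+ 2 <= 0.
    have: x2 0 i * y i <= x2 0 i * y i ^+ 2.
      by rewrite ler_pM2l // int_le_sqr.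
    by rewrite -Ey (bigD1 i) //= gerDl.
  have nonneg l : 0 <= x2 0 l * y l ^+ 2.
    by rewrite mulr_ge0 ?sqr_ge0 // ltW.
  have: x2 0 k * y k ^+ 2 <= 0.
    apply: le_trans yk0; rewrite (bigD1 k) //= lerDl.
    by apply: sumr_ge0.
  move=> le0; have /eqP : x2 0 k * y k ^+ 2 = 0.
    by apply: le_anti; rewrite le0 nonneg.
  rewrite mulf_eq0 sqrf_eq0 gt_eqF //= mulf_eq0 (negPf Qij) /=.
  by move/eqP.
(* The diagonal of [M1 = M2 *m Q] gives a nonzero entry in each column of [Q],
   at a row that is above the column index for [le2]. *)
have [s s_nz] : exists s, forall j, (Q (s j) j != 0) && le2 j (s j).
  apply: (@fin_all_exists _ _ (fun j i => (Q i j != 0) && le2 j i)) => j.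
  have /eqP nz : M1 j j != 0 by rewrite (proj2 tr1).
  case: (pickP (fun i => M2 j i * Q i j != 0)) => [i | z]; last first.
    by case: nz; rewrite -M2Q mxE big1 // => i _; apply/eqP/negbFE/z.
  rewrite mulf_eq0 => /norP[/(proj1 tr2) le Qij].
  by exists i; rewrite Qij.
have [t t_nz] : exists t, forall i, R (t i) i != 0.
  apply: (@fin_all_exists _ _ (fun i j => R j i != 0)) => i.
  have /eqP nz : M2 i i != 0 by rewrite (proj2 tr2).
  case: (pickP (fun j => R j i != 0)) => [j | z]; first by exists j.
  case: nz; rewrite -M1R mxE big1 // => j _.
  by have/negbFE/eqP-> := z j; rewrite mulr0.
have QR i j k : Q i j != 0 -> R j k != 0 -> k = i.
  by move=> /Rrow Rj0; apply: contraNeq => /Rj0->.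
have ts : cancel t s.
  by move=> i; case/andP: (s_nz (t i)) => /QR/(_ (t_nz i)) <-.
have s_id : s =1 id.
  apply: (inflationary_inj_id po2); first exact: can_inj (canF_sym ts).
  by move=> j; case/andP: (s_nz j).
have t_id i : t i = i by rewrite -[LHS]s_id ts.
have Q0 i j : i != j -> Q i j = 0.
  apply: contraNeq => /QR/(_ (_ : R j j != 0)) <- //.
  by have := t_nz j; rewrite t_id.
apply/matrixP => i j.
have M1E k : M1 k j = M2 k j * Q j j.
  by rewrite -M2Q mxE (bigD1 j) //= big1 ?addr0 // => l /Q0->; rewrite mulr0.
have := M1E j; rewrite (proj2 tr1) (proj2 tr2) mul1r => Q1.
by rewrite M1E -Q1 mulr1.
Qed.

Lemma symmetric_factorization_unique le1 le2 B M1 M2 D1 D2 :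
  partial_order le1 -> partial_order le2 ->
  unitriangular le1 M1 -> unitriangular le2 M2 ->
  upper le1 D1^T -> upper le2 D2^T ->
  (forall i, 0 < D1 i i) -> (forall i, 0 < D2 i i) ->
  B^T = B -> B = M1 *m D1 -> B = M2 *m D2 -> D1 = D2.
Proof.
move=> po1 po2 tr1 tr2 up1 up2 pos1 pos2 symB B1 B2.
have [|x1 Ex1 xD1] := symmetric_LDU po1 tr1 up1; first by rewrite -B1.
have [|x2 Ex2 xD2] := symmetric_LDU po2 tr2 up2; first by rewrite -B2.
have eqM : M1 = M2.
  apply: (unitriangular_congruence_unique (x1 := x1) (x2 := x2)
    po1 po2 tr1 tr2).
  - by move=> i; rewrite xD1.
  - by move=> i; rewrite xD2.
  - by rewrite -Ex1 -Ex2 -B1.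
apply: (can_inj (mulKmx (unitriangular_unit po1 tr1))).
by rewrite -B1 eqM.
Qed.

End UnitriangularMatrices.

(** The same uniqueness for tables of multiplicities indexed by a finite type:
    [b] stands for the weighted Cartan matrix, [d] for the characters of the
    standard modules and [m] for their multiplicities in projective modules. *)
Lemma triangular_factor_unique (T : finType) (le1 le2 : rel T)
    (b m1 m2 d1 d2 : T -> T -> nat) :
  partial_order le1 -> partial_order le2 ->
  (forall x y, b x y = b y x) ->
  (forall x, m1 x x = 1%N) -> (forall x, m2 x x = 1%N) ->
  (forall x y, m1 x y != 0%N -> le1 x y) ->
  (forall x y, m2 x y != 0%N -> le2 x y) ->
  (forall x, d1 x x != 0%N) -> (forall x, d2 x x != 0%N) ->
  (forall x y, d1 x y != 0%N -> le1 y x) ->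
  (forall x y, d2 x y != 0%N -> le2 y x) ->
  (forall x z, b x z = \sum_y m1 x y * d1 y z)%N ->
  (forall x z, b x z = \sum_y m2 x y * d2 y z)%N ->
  forall x y, d1 x y = d2 x y.
Proof.
move=> po1 po2 symb m1_1 m2_1 m1_le m2_le d1_0 d2_0 d1_le d2_le b1 b2.
pose mx (f : T -> T -> nat) : 'M[int]_#|T| :=
  \matrix_(i, j) (f (enum_val i) (enum_val j))%:Z.
pose re (le : rel T) : rel 'I_#|T| := fun i j => le (enum_val i) (enum_val j).
have po_re le : partial_order le -> partial_order (re le).
  case=> le_refl le_anti le_trans; split=> [i | i j ij | j i k].
  - exact: le_refl.
  - exact/enum_val_inj/le_anti.
  - exact: le_trans.
have uni (le : rel T) m : (forall x, m x x = 1%N) ->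
    (forall x y, m x y != 0%N -> le x y) ->
    unitriangular (re le) (mx m).
  move=> m_1 m_le; split=> [i j | i]; rewrite mxE ?m_1 //.
  by rewrite eqz_nat => /m_le.
have up (le : rel T) d :
    (forall x y, d x y != 0%N -> le y x) -> upper (re le) (mx d)^T.
  by move=> d_le i j; rewrite !mxE eqz_nat => /d_le.
have pos d : (forall x, d x x != 0%N) -> forall i, 0 < mx d i i.
  by move=> d_0 i; rewrite mxE ltz_nat lt0n.
have mulE m d : (forall x z, b x z = \sum_y m x y * d y z)%N ->
    mx b = mx m *m mx d.
  move=> bE; apply/matrixP => i k; rewrite !mxE bE.
  rewrite (reindex (@enum_val T T)) /=; last exact: (onW_bij _ (enum_val_bij T)).
  rewrite (big_morph Posz PoszD (erefl _)).
  by apply: eq_bigr => j _; rewrite !mxE PoszM.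
have sym : (mx b)^T = mx b by apply/matrixP => i j; rewrite !mxE symb.
have E := symmetric_factorization_unique (po_re _ po1) (po_re _ po2)
  (uni _ _ m1_1 m1_le) (uni _ _ m2_1 m2_le) (up _ _ d1_le) (up _ _ d2_le)
  (pos _ d1_0) (pos _ d2_0) sym (mulE _ _ b1) (mulE _ _ b2).
move=> x y; have /matrixP/(_ (enum_rank x) (enum_rank y)) := E.
by rewrite !mxE !enum_rankK => -[].
Qed.

(** * Homomorphisms and submodules *)

Section Homs.
Variables (K : fieldType) (A : falgType K).
Implicit Types (M N X Y Z S T : fdmod A).

Lemma is_hom_id M : is_hom (\1%VF : 'Hom(M, M)).
Proof. by move=> a v; rewrite !id_lfunE. Qed.

Lemma is_hom_comp M N X (f : 'Hom(M, N)) (g : 'Hom(N, X)) :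
  is_hom f -> is_hom g -> is_hom (g \o f)%VF.
Proof. by move=> hf hg a v; rewrite !comp_lfunE hf hg. Qed.

Lemma is_hom0 M N : is_hom (0 : 'Hom(M, N)).
Proof. by move=> a v; rewrite !lfunE /= linear0. Qed.

Lemma lker_trivP M N (f : 'Hom(M, N)) : lker f = 0%VS <-> injective f.
Proof. by split=> [/eqP/lker0P | /lker0P/eqP]. Qed.

Lemma limg_fullP M N (f : 'Hom(M, N)) :
  limg f = fullv <-> forall y, exists x, y = f x.
Proof.
split=> [E y | surj].
  by have := memvf y; rewrite -E => /memv_imgP[x _ ->]; exists x.
by apply/vspaceP => y; have [x ->] := surj y; rewrite memv_img ?memvf.
Qed.

(** By the kernel condition [k \o g^-1] does not depend on the choice of the linear
    section [g^-1], and therefore it is a homomorphism. *)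
Lemma factor_epi M N Y (g : 'Hom(M, N)) (k : 'Hom(M, Y)) :
  is_hom g -> limg g = fullv -> is_hom k -> (lker g <= lker k)%VS ->
  exists2 k' : 'Hom(N, Y), is_hom k' & (k' \o g)%VF = k.
Proof.
move=> hg sg hk sK.
have gV y : g ((g^-1)%VF y) = y by rewrite limg_lfunVK // sg memvf.
have kg v : k ((g^-1)%VF (g v)) = k v.
  apply/eqP; rewrite -subr_eq0 -raddfB -memv_ker (subvP sK) // memv_ker.
  by rewrite raddfB /= gV subrr.
exists (k \o g^-1)%VF; last by apply/lfunP => v; rewrite !comp_lfunE.
by move=> a y; rewrite !comp_lfunE -hk -[in LHS](gV y) -hg kg.
Qed.

Lemma factor_mono M X Y (f : 'Hom(X, Y)) (k : 'Hom(M, Y)) :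
  is_hom f -> lker f = 0%VS -> is_hom k -> (limg k <= limg f)%VS ->
  exists2 k' : 'Hom(M, X), is_hom k' & (f \o k')%VF = k.
Proof.
move=> hf /lker_trivP inj_f hk sI.
have fV v : f ((f^-1)%VF (k v)) = k v.
  by rewrite limg_lfunVK // (subvP sI) // memv_img ?memvf.
exists (f^-1 \o k)%VF; last by apply/lfunP => v; rewrite !comp_lfunE.
by move=> a v; apply: inj_f; rewrite hf !comp_lfunE !fV hk.
Qed.

Lemma mod_isoP M N :
  mod_iso M N <->
  exists f : 'Hom(M, N), [/\ is_hom f, lker f = 0%VS & limg f = fullv].
Proof.
split=> [[f hf bij_f] | [f [hf /lker_trivP inj_f /limg_fullP surj_f]]].
  exists f; split=> //; first exact/lker_trivP/bij_inj.
  by case: bij_f => g _ gK; apply/limg_fullP => y; exists (g y).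
exists f => //; exists (f^-1)%VF => [v | y].
  by rewrite lker0_lfunK //; apply/lker0P.
by rewrite limg_lfunVK //; have [x ->] := surj_f y; rewrite memv_img ?memvf.
Qed.

Lemma mod_iso_inv M N (f : 'Hom(M, N)) :
  is_hom f -> bijective f ->
  exists g : 'Hom(N, M),
    [/\ is_hom g, (g \o f)%VF = \1%VF & (f \o g)%VF = \1%VF].
Proof.
move=> hf [g fK gK].
have sur_f : limg f = fullv by apply/limg_fullP => y; exists (g y).
have ker_f : (lker f <= lker (\1%VF : 'End(M)))%VS.
  by rewrite (proj2 (lker_trivP f)) ?sub0v //; exact: can_inj fK.
have [h hh hE] := factor_epi hf sur_f (@is_hom_id M) ker_f.
exists h; split=> //; apply/lfunP => y; rewrite comp_lfunE id_lfunE -[y]gK.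
by rewrite -[h _](comp_lfunE h f) hE id_lfunE.
Qed.

Lemma mod_iso_sym M N : mod_iso M N -> mod_iso N M.
Proof.
case=> f hf bf; have [g [hg gf fg]] := mod_iso_inv hf bf.
exists g => //; exists f => v; rewrite -comp_lfunE ?gf ?fg id_lfunE //.
Qed.

Lemma zero_img M N (f : 'Hom(M, N)) : limg f = fullv -> f = 0 -> {:N}%VS = 0%VS.
Proof.
move=> sur_f f0; rewrite -sur_f f0; apply/eqP; rewrite -subv0.
by apply/subvP => _ /memv_imgP[u _ ->]; rewrite lfunE mem0v.
Qed.

Lemma simple_epi_neq0 M S (f : 'Hom(M, S)) :
  simple_mod S -> limg f = fullv -> f <> 0.
Proof. by move=> [S0 _] sur_f /(zero_img sur_f). Qed.

Lemma ker_subm_proof M N (f : 'Hom(M, N)) (hf : is_hom f) a v :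
  v \in lker f -> act M a v \in lker f.
Proof. by rewrite !memv_ker hf => /eqP->; rewrite linear0. Qed.

Definition ker_subm M N (f : 'Hom(M, N)) (hf : is_hom f) : submodule M :=
  Submodule (ker_subm_proof hf).

Lemma preim_subm_proof M N (f : 'Hom(M, N)) (hf : is_hom f) (W : submodule N)
  a v : v \in (f @^-1: W)%VS -> act M a v \in (f @^-1: W)%VS.
Proof. by rewrite -!memv_preim hf; apply: submP. Qed.

Definition preim_subm M N (f : 'Hom(M, N)) (hf : is_hom f) (W : submodule N) :
  submodule M := Submodule (preim_subm_proof hf (W := W)).

Lemma im_subm_proof M N (f : 'Hom(M, N)) (hf : is_hom f) (U : submodule M)
  a v : v \in (f @: U)%VS -> act N a v \in (f @: U)%VS.
Proof. by case/memv_imgP=> u Uu ->; rewrite -hf memv_img ?submP. Qed.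

Definition im_subm M N (f : 'Hom(M, N)) (hf : is_hom f) (U : submodule M) :
  submodule N := Submodule (im_subm_proof hf (U := U)).

Lemma simple_epi M S (f : 'Hom(M, S)) :
  simple_mod S -> is_hom f -> f != 0 -> limg f = fullv.
Proof.
move=> [_ simS] hf nzf; have [/= f0 | //] := simS (im_subm hf (full_subm M)).
case/eqP: nzf; apply/lfunP => v; apply/eqP; rewrite lfunE -memv0 -f0.
exact/memv_img/memvf.
Qed.

Lemma simple_mono S N (f : 'Hom(S, N)) :
  simple_mod S -> is_hom f -> f != 0 -> lker f = 0%VS.
Proof.
move=> [_ simS] hf nzf; have [//| /= fT] := simS (ker_subm hf).
case/eqP: nzf; apply/lfunP => v; apply/eqP; rewrite lfunE -memv_ker fT.
exact: memvf.
Qed.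

Lemma simple_hom_iso S T (f : 'Hom(S, T)) :
  simple_mod S -> simple_mod T -> is_hom f -> f != 0 -> mod_iso S T.
Proof.
move=> sS sT hf nzf; apply/mod_isoP; exists f.
by rewrite (simple_epi sT) // (simple_mono sS).
Qed.

(** The image of [U] in the simple module [S] is zero or everything. *)
Lemma simple_ker_dichotomy M S (f : 'Hom(M, S)) (U : submodule M) :
  simple_mod S -> is_hom f ->
  (U <= lker f)%VS \/ (U + lker f)%VS = fullv.
Proof.
move=> [_ simS] hf; have [/= f0 | /= fT] := simS (im_subm hf U); [left | right].
  by apply/subvP => v Uv; rewrite memv_ker -memv0 -f0 memv_img.
apply/vspaceP => v; rewrite memvf.
have : f v \in (f @: U)%VS by rewrite fT memvf.
case/memv_imgP => w Uw Ew; apply/memv_addP; exists w => //.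
by exists (v - w); [rewrite memv_ker raddfB /= Ew subrr | rewrite addrC subrK].
Qed.

Definition subm_incl M (U : submodule M) : 'Hom(submod U, M) := linfun vsval.

Lemma subm_inclE M (U : submodule M) (x : submod U) :
  subm_incl U x = vsval x.
Proof. by rewrite lfunE. Qed.

Lemma subm_incl_mem M (U : submodule M) x : subm_incl U x \in (U : {vspace M}).
Proof. by rewrite subm_inclE (subvP (diffvSl _ _) _ (subvsP x)). Qed.

Lemma subm_incl_hom M (U : submodule M) : is_hom (subm_incl U).
Proof.
move=> a x; have Ux := subm_incl_mem x; rewrite !subm_inclE in Ux *.
rewrite [act (submod U) a x]subquot_actE.
have := subquot_proj_sub (zero_subm M) (submP a Ux).
by rewrite memv0 subr_eq0 => /eqP.
Qed.

Lemma subm_incl_ker M (U : submodule M) : lker (subm_incl U) = 0%VS.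
Proof. by apply/lker_trivP => x y; rewrite !subm_inclE; apply: val_inj. Qed.

Lemma subm_incl_img M (U : submodule M) : limg (subm_incl U) = U.
Proof.
apply/vspaceP => v; apply/memv_imgP/idP => [[x _ ->] | Uv].
  exact: subm_incl_mem.
exists (subquot_proj U (zero_subm M) v); rewrite ?memvf // subm_inclE.
have := subquot_proj_sub (zero_subm M) Uv.
by rewrite memv0 subr_eq0 => /eqP.
Qed.

Lemma zero_submod_eq0 M (z : submod (zero_subm M)) : z = 0.
Proof.
apply: (proj1 (lker_trivP _) (subm_incl_ker (zero_subm M))).
by have := subm_incl_mem z; rewrite memv0 linear0 => /eqP.
Qed.

Definition quo_proj M (U : submodule M) : 'Hom(M, quomod U) :=
  subquot_proj (full_subm M) U.

Lemma quo_proj_hom M (U : submodule M) : is_hom (quo_proj U).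
Proof. by move=> a v; apply: subquot_act_proj; rewrite memvf. Qed.

Lemma quo_proj_img M (U : submodule M) : limg (quo_proj U) = fullv.
Proof. by have [_ + _] := subquot_projP (full_subm M) U. Qed.

Lemma quo_proj_ker M (U : submodule M) : lker (quo_proj U) = U.
Proof. by have [_ _] := subquot_projP (full_subm M) U; rewrite !capfv. Qed.

End Homs.

Arguments is_hom_id {K A} M.
Arguments is_hom0 {K A} M N.
Arguments subm_incl_hom {K A M} U.
Arguments quo_proj_hom {K A M} U.

(** * Exact sequences, additive functions and composition series *)

Section Exactness.
Variables (K : fieldType) (A : falgType K).
Implicit Types (M N X Y Z S : fdmod A).

Record ses X Y Z (f : 'Hom(X, Y)) (g : 'Hom(Y, Z)) : Prop := Ses {
  ses_homl : is_hom f;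
  ses_homr : is_hom g;
  ses_mono : lker f = 0%VS;
  ses_exact : limg f = lker g;
  ses_epi : limg g = fullv }.

Lemma ses_quo M (U : submodule M) : ses (subm_incl U) (quo_proj U).
Proof.
split; [exact: subm_incl_hom | exact: quo_proj_hom | exact: subm_incl_ker
  | by rewrite subm_incl_img quo_proj_ker | exact: quo_proj_img].
Qed.

Lemma ses_coker X Y (f : 'Hom(X, Y)) (hf : is_hom f) :
  lker f = 0%VS -> ses f (quo_proj (im_subm hf (full_subm X))).
Proof.
split=> //; [exact: quo_proj_hom | by rewrite quo_proj_ker
  | exact: quo_proj_img].
Qed.

Lemma ses_ker Y Z (g : 'Hom(Y, Z)) (hg : is_hom g) :
  limg g = fullv -> ses (subm_incl (ker_subm hg)) g.
Proof.
by split=> //; [exact: subm_incl_hom | exact: subm_incl_ker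
  | rewrite subm_incl_img].
Qed.

(** The last condition lets submodules of the subquotient be compared with
    submodules of [M] between [U] and [V]. *)
Lemma ses_subquot M (U V : submodule M) : (U <= V)%VS ->
  exists f : 'Hom(submod U, submod V), exists g : 'Hom(submod V, subquot V U),
    ses f g /\ (subm_incl V @: lker g)%VS = U.
Proof.
move=> sUV.
have [|j hj jE] := factor_mono (subm_incl_hom V) (subm_incl_ker V)
  (subm_incl_hom U); first by rewrite !subm_incl_img.
pose g : 'Hom(submod V, subquot V U) := (subquot_proj V U \o subm_incl V)%VF.
have gE x : g x = subquot_proj V U (subm_incl V x) by exact: comp_lfunE.
have jv x : subm_incl V (j x) = subm_incl U x by rewrite -jE comp_lfunE.
have [ph pi pk] := subquot_projP V U.
have gker x : (x \in lker g) = (subm_incl V x \in (U : {vspace M})).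
  have := congr1 (fun W : {vspace M} => subm_incl V x \in W) pk.
  by rewrite !memv_cap subm_incl_mem /= memv_ker => <-; rewrite memv_ker gE.
have hg : is_hom g.
  by move=> a x; rewrite !gE subm_incl_hom ph ?subm_incl_mem.
exists j, g; split; first split=> //.
- apply/lker_trivP => x y /(congr1 (subm_incl V)); rewrite !jv.
  by move: x y; apply/lker_trivP/subm_incl_ker.
- apply/vspaceP => x; rewrite gker; apply/memv_imgP/idP => [[y _ ->]|].
    by rewrite jv subm_incl_mem.
  rewrite -{1}(subm_incl_img U) => /memv_imgP[y _ Ey].
  exists y; rewrite ?memvf //.
  by apply: (proj1 (lker_trivP _) (subm_incl_ker V)); rewrite jv.
- by rewrite limg_comp subm_incl_img.
apply/vspaceP => v; apply/memv_imgP/idP => [[x + ->]|Uv].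
  by rewrite gker.
have: v \in limg (subm_incl V) by rewrite subm_incl_img (subvP sUV).
by case/memv_imgP => x _ Ev; exists x; rewrite // gker -Ev.
Qed.

(** Additive functions play the role of characters here: the multiplicity of a
    simple module, up to a constant factor, is such a function, and its
    additivity replaces the Jordan-Hoelder theorem. *)
Definition ses_additive (phi : fdmod A -> nat) :=
  forall X Y Z (f : 'Hom(X, Y)) (g : 'Hom(Y, Z)), ses f g ->
    phi Y = (phi X + phi Z)%N.

Lemma dim_additive : ses_additive (fun M => \dim {:M}).
Proof.
move=> X Y Z f g [_ _ injf ex surg].
rewrite -(limg_ker_dim g fullv) surg capfv -ex limg_dim_eq //.
by rewrite injf capv0.
Qed.

Section Additive.
Variables (phi : fdmod A -> nat) (add_phi : ses_additive phi).

(** The zero sequence on a zero module is exact, so the value at it is twice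
    itself. *)
Lemma additive_zero M : {:M}%VS = 0%VS -> phi M = 0%N.
Proof.
move=> M0; have M0' (v : M) : v = 0 by apply/eqP; rewrite -memv0 -M0 memvf.
suff /add_phi : ses (0 : 'Hom(M, M)) (0 : 'Hom(M, M)) by lia.
have E (U V : {vspace M}) : U = V.
  by apply/vspaceP => v; rewrite (M0' v) !mem0v.
by split=> //; apply: is_hom0.
Qed.

Lemma additive_mono X Y (f : 'Hom(X, Y)) :
  is_hom f -> lker f = 0%VS -> (phi X <= phi Y)%N.
Proof. by move=> hf /(ses_coker hf)/add_phi->; rewrite leq_addr. Qed.

Lemma additive_epi Y Z (g : 'Hom(Y, Z)) :
  is_hom g -> limg g = fullv -> (phi Z <= phi Y)%N.
Proof. by move=> hg /(ses_ker hg)/add_phi->; rewrite leq_addl. Qed.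

Lemma additive_iso M N : mod_iso M N -> phi M = phi N.
Proof.
case/mod_isoP => f [hf inj_f sur_f]; apply/eqP; rewrite eqn_leq.
by rewrite (additive_mono hf) // (additive_epi hf).
Qed.

Lemma additive_filtration M (s : seq (submodule M)) :
  is_filtration s -> phi M = (\sum_(X <- subquotients s) phi X)%N.
Proof.
case=> path_s last_s.
have phi0 : phi (submod (zero_subm M)) = 0%N.
  apply: additive_zero; apply/eqP; rewrite -subv0; apply/subvP => x _.
  by rewrite memv0; apply/eqP/zero_submod_eq0.
have <- : phi (submod (last (zero_subm M) s)) = phi M.
  apply: additive_iso; apply/mod_isoP; exists (subm_incl _).
  rewrite subm_incl_ker subm_incl_img last_s; split=> //.
  exact: subm_incl_hom.
suff -> : phi (submod (last (zero_subm M) s)) =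
    (phi (submod (zero_subm M)) + \sum_(X <- subquotients s) phi X)%N.
  by rewrite phi0.
rewrite /subquotients.
elim: s (zero_subm M) path_s {last_s phi0} => [|V s IH] U /=.
  by rewrite big_nil addn0.
case/andP => sUV /IH->; rewrite big_cons addnA; congr addn.
by have [f [g [/add_phi]]] := ses_subquot sUV.
Qed.

End Additive.

Lemma nonzero_dim M : ({:M} <> 0)%VS -> (0 < \dim {:M})%N.
Proof. by move/eqP; rewrite lt0n dimv_eq0. Qed.

Lemma additive_ext (phi psi : fdmod A -> nat) :
  ses_additive phi -> ses_additive psi ->
  (forall S, simple_mod S -> phi S = psi S) -> forall M, phi M = psi M.
Proof.
move=> add_phi add_psi simE M; have [m] := ubnP (\dim {:M}).
elim: m M => // m IH M; rewrite ltnS => le_m.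
have [M0 | /nonzero_dim M_gt0] := pselect ({:M} = 0)%VS.
  by rewrite !additive_zero.
have [/simE // | nsim] := pselect (simple_mod M).
have [U [U0 UT]] : exists U : submodule M,
    (U <> 0 :> {vspace M})%VS /\ U <> fullv :> {vspace M}.
  apply: contrapT => noU; apply: nsim; split.
    by move=> M0; move: M_gt0; rewrite M0 dimv0.
  move=> U; have [|U0] := pselect (U = 0 :> {vspace M})%VS; [by left | right].
  by apply: contrapT => UT; apply: noU; exists U.
have seU := ses_quo U.
have dimE := dim_additive seU.
have dimU : \dim {:submod U} = \dim U.
  have := limg_dim_eq (f := subm_incl U) (U := fullv).
  by rewrite subm_incl_ker capv0 subm_incl_img => ->.
have U_gt0 : (0 < \dim U)%N by rewrite lt0n dimv_eq0; apply/eqP.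
have U_lt : (\dim U < \dim {:M})%N.
  rewrite ltn_neqAle dimvS ?subvf // andbT; apply: contra_notN UT => /eqP dE.
  by apply/eqP; rewrite eqEdim subvf /= dE.
rewrite (add_phi _ _ _ _ _ seU) (add_psi _ _ _ _ _ seU) !IH //; lia.
Qed.

Lemma simple_subquot M (U V : submodule M) : (U <= V)%VS ->
  U <> V :> {vspace M} ->
  (forall W : submodule M, (U <= W)%VS -> (W <= V)%VS ->
     W = U :> {vspace M} \/ W = V :> {vspace M}) ->
  simple_mod (subquot V U).
Proof.
move=> sUV nUV maxU.
have [f [g [[hf hg inj_f ex sur_g] imU]]] := ses_subquot sUV.
split=> [Q0 | W].
  apply: nUV; rewrite -imU -(subm_incl_img V); congr lfun_img.
  apply/vspaceP => x; rewrite memvf memv_ker -memv0 -Q0 memvf //.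
pose W' := im_subm (subm_incl_hom V) (preim_subm hg W).
have [|| /= E | /= E] := maxU W'.
- rewrite -imU limgS //; apply/subvP => x.
  by rewrite memv_ker -memv_preim => /eqP->; rewrite mem0v.
- by rewrite -[X in (_ <= X)%VS](subm_incl_img V) /= limgS ?subvf.
- left; apply/eqP; rewrite -subv0; apply/subvP => y Wy.
  have /limg_fullP/(_ y)[x Ey] := sur_g.
  have : subm_incl V x \in (subm_incl V @: lker g)%VS.
    by rewrite imU -E memv_img // -memv_preim -Ey.
  case/memv_imgP => [x' kx' /(proj1 (lker_trivP _) (subm_incl_ker V)) Ex].
  by move: kx'; rewrite memv_ker -Ex -Ey memv0.
right; apply/vspaceP => y; rewrite memvf.
have /limg_fullP/(_ y)[x ->] := sur_g.
have : subm_incl V x \in (subm_incl V @: (g @^-1: W))%VS.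
  by rewrite E subm_incl_mem.
case/memv_imgP => [x' kx' /(proj1 (lker_trivP _) (subm_incl_ker V)) ->].
by rewrite memv_preim.
Qed.

Lemma submodule_inj M (U V : submodule M) : U = V :> {vspace M} -> U = V.
Proof.
case: U V => [U hU] [V hV] /= E; case: _ / E hV => hV.
by congr Submodule; exact: Prop_irrelevance.
Qed.

(** A submodule of largest dimension among the proper submodules of [V] is
    maximal, so the series is built downwards from the top. *)
Lemma composition_series_exists M :
  exists s : seq (submodule M), composition_series s.
Proof.
suff H (V : submodule M) : exists s : seq (submodule M),
    [/\ path (fun U W : submodule M => (U <= W)%VS) (zero_subm M) s,
        last (zero_subm M) s = V
      & all (fun X => `[< simple_mod X >]) (subquotients s)].
  have [s [ps ls sims]] := H (full_subm M).
  by exists s; split=> //; split=> //; rewrite ls.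
have [m] := ubnP (\dim V); elim: m V => // m IH V; rewrite ltnS => le_m.
have [V0 | V0] := pselect (V = 0 :> {vspace M})%VS.
  by exists [::]; split=> //=; apply: submodule_inj.
pose proper_dim d := `[< exists2 U : submodule M,
  (U <= V)%VS && (U != V :> {vspace M}) & \dim U = d >].
have ex0 : exists d, proper_dim d.
  exists (\dim (zero_subm M)); apply/asboolP; exists (zero_subm M) => //.
  by rewrite sub0v /= eq_sym; apply/eqP.
have ub d : proper_dim d -> (d <= \dim V)%N.
  by move=> /asboolP[U /andP[sUV _] <-]; rewrite dimvS.
have [d /asboolP[U /andP[sUV nUV] dU] maxd] := ex_maxnP ex0 ub.
have ltUV : (\dim U < \dim V)%N.
  by rewrite ltnNge; apply: contra nUV => ?; rewrite eqEdim sUV.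
have [s [ps ls sims]] := IH U (leq_trans ltUV le_m).
exists (rcons s V); rewrite rcons_path ps last_rcons ls sUV; split=> //.
rewrite /subquotients -cats1 pairmap_cat all_cat sims /= ls andbT.
apply/asboolP/simple_subquot => //; first exact/eqP.
move=> W sUW sWV; have [|nWV] := pselect (W = V :> {vspace M}).
  by right.
left.
apply/esym/eqP; rewrite eqEdim sUW dU maxd //; apply/asboolP; exists W => //.
by rewrite sWV; apply/eqP.
Qed.

End Exactness.

(** * Dimensions of Hom spaces and projective covers *)

Section CompLinear.
Variables (K : fieldType) (U V W : vectType K).

Definition postcomp_fun (g : 'Hom(V, W)) (f : 'Hom(U, V)) := (g \o f)%VF.
Definition precomp_fun (g : 'Hom(U, V)) (f : 'Hom(V, W)) := (f \o g)%VF.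

Lemma postcomp_linear g : linear (postcomp_fun g).
Proof. by move=> k f1 f2; rewrite /postcomp_fun comp_lfunDr comp_lfunZr. Qed.

Lemma precomp_linear g : linear (precomp_fun g).
Proof. by move=> k f1 f2; rewrite /precomp_fun comp_lfunDl comp_lfunZl. Qed.

HB.instance Definition _ g :=
  GRing.isLinear.Build K _ _ _ (postcomp_fun g) (postcomp_linear g).
HB.instance Definition _ g :=
  GRing.isLinear.Build K _ _ _ (precomp_fun g) (precomp_linear g).

Definition postcomp g := linfun (postcomp_fun g).
Definition precomp g := linfun (precomp_fun g).

Lemma postcompE g f : postcomp g f = (g \o f)%VF. Proof. exact: lfunE. Qed.
Lemma precompE g f : precomp g f = (f \o g)%VF. Proof. exact: lfunE. Qed.

Lemma postcomp_ker g : lker g = 0%VS -> lker (postcomp g) = 0%VS.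
Proof.
move/eqP/lker0P => inj_g; apply/eqP/lker0P => f1 f2; rewrite !postcompE.
move/lfunP => E; apply/lfunP => u; have := E u.
by rewrite !comp_lfunE => /inj_g.
Qed.

Lemma precomp_ker g : limg g = fullv -> lker (precomp g) = 0%VS.
Proof.
move=> sur_g; apply/eqP/lker0P => f1 f2; rewrite !precompE.
move/lfunP => E; apply/lfunP => v.
have : v \in limg g by rewrite sur_g memvf.
by case/memv_imgP => u _ ->; have := E u; rewrite !comp_lfunE.
Qed.

Lemma comp_mono_eq0 (g : 'Hom(V, W)) (f : 'Hom(U, V)) :
  lker g = 0%VS -> (g \o f)%VF = 0 -> f = 0.
Proof.
move/postcomp_ker/eqP/lker0P => inj gf0; apply: inj.
by rewrite !postcompE gf0 comp_lfun0r.
Qed.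

Lemma comp_epi_eq0 (g : 'Hom(U, V)) (f : 'Hom(V, W)) :
  limg g = fullv -> (f \o g)%VF = 0 -> f = 0.
Proof.
move/precomp_ker/eqP/lker0P => inj fg0; apply: inj.
by rewrite !precompE fg0 comp_lfun0l.
Qed.

End CompLinear.

Section HomDim.
Variables (K : fieldType) (A : falgType K).
Implicit Types (M N X Y Z S P J L : fdmod A).

Definition hdim M N := \dim (homv M N).

Lemma hdim0P M N : hdim M N = 0%N <-> forall f : 'Hom(M, N), is_hom f -> f = 0.
Proof.
split=> [/eqP | h0]; first rewrite dimv_eq0 => /eqP H f /homvP.
  by rewrite H memv0 => /eqP.
apply/eqP; rewrite dimv_eq0 -subv0; apply/subvP => f /homvP/h0 ->.
exact: mem0v.
Qed.

(** Left exactness of Hom holds for every module; lifting along [g] gives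
    surjectivity on the right.  Next comes the dual argument. *)
Lemma hdim_projective P : projective_mod P -> ses_additive (hdim P).
Proof.
move=> projP X Y Z f g [hf hg inj_f ex sur_g].
have kf : lker (postcomp P f) = 0%VS by exact: postcomp_ker.
rewrite /hdim -(limg_ker_dim (postcomp P g)); congr addn.
  rewrite -[RHS](limg_dim_eq (f := postcomp P f)) ?kf ?capv0 //; congr (\dim _).
  apply/vspaceP => k; rewrite memv_cap memv_ker postcompE.
  apply/andP/memv_imgP => [[/homvP hk /eqP gk0] | [k' /homvP hk' ->]].
    have [|k' hk' <-] := factor_mono hf inj_f hk.
      apply/subvP => _ /memv_imgP[u _ ->]; rewrite ex memv_ker.
      by rewrite -comp_lfunE gk0 lfunE.
    by exists k'; [exact/homvP | rewrite postcompE].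
  rewrite postcompE; split; first exact/homvP/is_hom_comp.
  apply/eqP/lfunP => u; rewrite !comp_lfunE lfunE; apply/eqP.
  by rewrite -memv_ker -ex memv_img ?memvf.
congr (\dim _); apply/vspaceP => k.
apply/memv_imgP/idP => [[k' /homvP hk' ->] | /homvP hk].
  by rewrite postcompE; exact/homvP/is_hom_comp.
have [h hh <-] := projP _ _ _ _ hg sur_g hk.
by exists h; [exact/homvP | rewrite postcompE].
Qed.

Lemma hdim_injective J : injective_mod J -> ses_additive (fun M => hdim M J).
Proof.
move=> injJ X Y Z f g [hf hg inj_f ex sur_g].
have kg : lker (precomp J g) = 0%VS by exact: precomp_ker.
rewrite addnC /hdim -(limg_ker_dim (precomp J f)); congr addn.
  rewrite -[RHS](limg_dim_eq (f := precomp J g)) ?kg ?capv0 //; congr (\dim _).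
  apply/vspaceP => k; rewrite memv_cap memv_ker precompE.
  apply/andP/memv_imgP => [[/homvP hk /eqP kf0] | [k' /homvP hk' ->]].
    have [|k' hk' <-] := factor_epi hg sur_g hk.
      rewrite -ex; apply/subvP => _ /memv_imgP[u _ ->]; rewrite memv_ker.
      by rewrite -comp_lfunE kf0 lfunE.
    by exists k'; [exact/homvP | rewrite precompE].
  rewrite precompE; split; first exact/homvP/is_hom_comp.
  apply/eqP/lfunP => u; rewrite !comp_lfunE lfunE.
  have /eqP-> : g (f u) == 0 by rewrite -memv_ker -ex memv_img ?memvf.
  by rewrite linear0.
congr (\dim _); apply/vspaceP => k.
apply/memv_imgP/idP => [[k' /homvP hk' ->] | /homvP hk].
  by rewrite precompE; exact/homvP/is_hom_comp.
have [h hh <-] := injJ _ _ _ _ hf inj_f hk.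
by exists h; [exact/homvP | rewrite precompE].
Qed.

Lemma hdim_iso M X Y : mod_iso X Y -> hdim M X = hdim M Y.
Proof.
case=> f hf bf; have [g [hg gf fg]] := mod_iso_inv hf bf.
have kf : lker (postcomp M f) = 0%VS.
  by apply/postcomp_ker/lker_trivP/bij_inj.
rewrite /hdim -(limg_dim_eq (f := postcomp M f)) ?kf ?capv0 //; congr (\dim _).
apply/vspaceP => k; apply/memv_imgP/idP => [[k' /homvP hk' ->] | /homvP hk].
  by rewrite postcompE; exact/homvP/is_hom_comp.
exists (g \o k)%VF; first exact/homvP/is_hom_comp.
by rewrite postcompE comp_lfunA fg comp_lfun1l.
Qed.

Section Cover.
Variables (P L : fdmod A) (p : 'Hom(P, L)).
Hypotheses (hp : is_hom p) (sur_p : limg p = fullv)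
  (sup_p : forall U : submodule P,
     (U + lker p)%VS = fullv -> U = fullv :> {vspace P}).

(** The kernel of the superfluous epimorphism [p] lies in the kernel of every
    map to a simple module: otherwise the two kernels would span [P]. *)
Lemma cover_factor S (k : 'Hom(P, S)) : simple_mod S -> is_hom k ->
  exists2 k' : 'Hom(L, S), is_hom k' & (k' \o p)%VF = k.
Proof.
move=> sS hk; apply: factor_epi => //.
have [// | pkT] := simple_ker_dichotomy (ker_subm hp) sS hk.
suff /= -> : ker_subm hk = fullv :> {vspace P} by exact: subvf.
by apply: sup_p; rewrite addvC.
Qed.

Lemma hdim_cover_top S : simple_mod S -> hdim P S = hdim L S.
Proof.
move=> sS; have kp : lker (precomp S p) = 0%VS by exact: precomp_ker.
rewrite /hdim -[RHS](limg_dim_eq (f := precomp S p)) ?kp ?capv0 //.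
congr (\dim _).
apply/vspaceP => k; apply/idP/memv_imgP => [/homvP hk | [k' /homvP hk' ->]].
  have [k' hk' <-] := cover_factor sS hk.
  by exists k'; [exact/homvP | rewrite precompE].
by rewrite precompE; exact/homvP/is_hom_comp.
Qed.
End Cover.

Lemma hdim_cover P L S : projective_cover P L -> simple_mod S ->
  hdim P S = hdim L S.
Proof. by case=> _ [p [hp sp sup]]; exact: (hdim_cover_top hp sp sup). Qed.

Lemma hdim_cover_simple P L S : projective_cover P L ->
  simple_mod L -> simple_mod S -> hdim P S <> 0%N <-> mod_iso S L.
Proof.
move=> cP sL sS; rewrite (hdim_cover cP sS) hdim0P; split=> [nz | iso].
  apply: contrapT => niso; apply: nz => f hf; apply: contrapT => /eqP nzf.
  by apply/niso/mod_iso_sym/(simple_hom_iso sL sS hf nzf).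
have [f [hf _ surf]] := (proj1 (mod_isoP _ _) (mod_iso_sym iso)).
by move/(_ f hf); exact: simple_epi_neq0.
Qed.

(** The dimension of Hom from the projective cover of [L] is additive and vanishes
    on exactly the simple modules that are not isomorphic to [L], so it detects
    whether [L] occurs in a composition series. *)
Lemma comp_factorP P L M : projective_cover P L -> simple_mod L ->
  comp_factor M L <-> hdim P M <> 0%N.
Proof.
move=> cP sL; have hadd := hdim_projective (proj1 cP).
have sumE (s : seq (fdmod A)) : all (fun X => `[< simple_mod X >]) s ->
    has (fun X => `[< mod_iso X L >]) s = ((\sum_(X <- s) hdim P X)%N != 0%N).
  elim: s => [|X s IH] /=; first by rewrite big_nil.
  case/andP=> /asboolP sX /IH->; rewrite big_cons addn_eq0 negb_and; congr orb.
  apply/idP/idP => [/asboolP|/eqP] /(hdim_cover_simple cP sL sX).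
    by move/eqP.
  by move=> iso; apply/asboolP.
split=> [[s [fs ss]] | nz].
  by rewrite sumE // -(additive_filtration hadd fs) => /eqP.
have [s [fs ss]] := composition_series_exists M.
by exists s => //; rewrite sumE // -(additive_filtration hadd fs); apply/eqP.
Qed.

End HomDim.

(** * Simple preserving dualities *)

Section Dual.
Variables (K : fieldType) (A : falgType K).
Implicit Types (M N X Y Z S P L W : fdmod A).

Section OneSided.
Variables F G : cofunctor A.
Hypothesis qFG : quasi_inverse F G.

Lemma cf_faithful M N (f g : 'Hom(M, N)) :
  is_hom f -> is_hom g -> cfmor F f = cfmor F g -> f = g.
Proof.
have [eta [eta_iso eta_nat]] := qFG; move=> hf hg E.
apply/lfunP => v; have [_ /bij_inj inj_eta] := eta_iso N; apply: inj_eta.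
by rewrite -!(comp_lfunE (eta N)) -!eta_nat // E.
Qed.

End OneSided.

Section Duality.
Variables F G : cofunctor A.
Hypotheses (qFG : quasi_inverse F G) (qGF : quasi_inverse G F).

Lemma cf_full M N (k : 'Hom(F M, F N)) : is_hom k ->
  exists2 g : 'Hom(N, M), is_hom g & cfmor F g = k.
Proof.
move=> hk; have [eta [eta_iso eta_nat]] := qFG.
have [hM bM] := eta_iso M; have [hN _] := eta_iso N.
have [e [he eM Me]] := mod_iso_inv hM bM.
have hGk : is_hom (cfmor G k) := cfmor_hom hk.
pose g := (e \o (cfmor G k \o eta N))%VF.
have hg : is_hom g by apply: is_hom_comp => //; apply: is_hom_comp.
exists g => //; apply: (cf_faithful qGF) => //; first exact: cfmor_hom.
have := eta_nat _ _ _ hg; rewrite /g !comp_lfunA Me comp_lfun1l => E.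
have [hN' bN] := eta_iso N; have [e' [_ _ Ne']] := mod_iso_inv hN' bN.
rewrite -[LHS]comp_lfun1r -[RHS]comp_lfun1r -Ne' !comp_lfunA.
by rewrite E.
Qed.

(** A functor need not preserve zero maps, but zero maps are those that factor
    through a module [Z] whose identity is zero, and by fullness [F Z] is such a
    module too. *)
Lemma cf_zero M N : cfmor F (0 : 'Hom(M, N)) = 0.
Proof.
pose Z := submod (zero_subm M).
have Z0 : forall z : Z, z = 0 by exact: zero_submod_eq0.
have [g hg Fg0] := cf_full (is_hom0 (F Z) (F Z)).
have id0 : \1%VF = 0 :> 'End(F Z).
  rewrite -(cfmor_id F) -Fg0; congr cfmor.
  by apply/lfunP => z; rewrite [LHS]Z0 [RHS]Z0.
have -> : (0 : 'Hom(M, N)) = ((0 : 'Hom(Z, N)) \o (0 : 'Hom(M, Z)))%VF.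
  by rewrite comp_lfun0l.
rewrite cfmor_comp; [|exact: is_hom0|exact: is_hom0].
by rewrite -[X in (_ \o X)%VF]comp_lfun1l id0 comp_lfun0l comp_lfun0r.
Qed.

(** Every module [W] is isomorphic to [F (G W)]; thus maps into and out of the
    values of [F], from or to an arbitrary module, come from maps in the other
    direction. *)
Lemma cf_hom_into W M (u : 'Hom(W, F M)) : is_hom u ->
  exists k : 'Hom(M, G W), exists e : 'Hom(W, F (G W)),
    [/\ is_hom k, is_hom e, bijective e & (cfmor F k \o e)%VF = u].
Proof.
move=> hu; have [eps [eps_iso _]] := qGF; have [he be] := eps_iso W.
have [e' [he' e'e ee']] := mod_iso_inv he be.
have [k hk kE] := cf_full (is_hom_comp he' hu).
by exists k, (eps W); split=> //; rewrite kE -comp_lfunA e'e comp_lfun1r.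
Qed.

Lemma cf_hom_from W M (u : 'Hom(F M, W)) : is_hom u ->
  exists k : 'Hom(G W, M), exists e : 'Hom(W, F (G W)),
    [/\ is_hom k, is_hom e, bijective e & (e \o u)%VF = cfmor F k].
Proof.
move=> hu; have [eps [eps_iso _]] := qGF; have [he be] := eps_iso W.
have [k hk kE] := cf_full (is_hom_comp hu he).
by exists k, (eps W).
Qed.

Lemma comp_bij0 M N X (u : 'Hom(M, N)) (e : 'Hom(X, M)) :
  bijective e -> (u \o e)%VF = 0 -> u = 0.
Proof.
case=> e' _ e'K E; apply/lfunP => v; rewrite -(e'K v) -comp_lfunE E.
by rewrite !lfunE.
Qed.

(** The inclusion of the kernel of [cfmor F g] comes from a map [k] that vanishes
    after [g], so it is zero.  The next two lemmas test cokernel and exactness in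
    the same way. *)
Lemma cf_mono M N (g : 'Hom(M, N)) :
  is_hom g -> limg g = fullv -> lker (cfmor F g) = 0%VS.
Proof.
move=> hg sg; have hFg : is_hom (cfmor F g) := cfmor_hom hg.
have hi := subm_incl_hom (ker_subm hFg).
have [k [e [hk he be ke]]] := cf_hom_into hi.
suff k0 : k = 0.
  rewrite -[LHS](subm_incl_img (ker_subm hFg)) -ke k0 cf_zero comp_lfun0l.
  apply/eqP; rewrite -subv0; apply/subvP => _ /memv_imgP[u _ ->].
  by rewrite lfunE mem0v.
have kg0 : (k \o g)%VF = 0.
  apply: (cf_faithful qFG); [exact: is_hom_comp | exact: is_hom0 |].
  rewrite cfmor_comp // cf_zero; apply: (comp_bij0 be).
  rewrite -comp_lfunA ke; apply/lfunP => x; apply/eqP.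
  by rewrite comp_lfunE zero_lfunE -memv_ker; exact: (subm_incl_mem x).
exact: comp_epi_eq0 sg kg0.
Qed.

Lemma cf_epi M N (g : 'Hom(M, N)) :
  is_hom g -> lker g = 0%VS -> limg (cfmor F g) = fullv.
Proof.
move=> hg kg; have hFg : is_hom (cfmor F g) := cfmor_hom hg.
pose I := im_subm hFg (full_subm _).
have [k [e [hk he be ek]]] := cf_hom_from (quo_proj_hom I).
suff k0 : k = 0.
  rewrite -[LHS](quo_proj_ker I); apply/vspaceP => x; rewrite memvf memv_ker.
  apply/eqP/(bij_inj be); rewrite -comp_lfunE ek k0 cf_zero lfunE /= linear0.
  by [].
have gk0 : (g \o k)%VF = 0.
  apply: (cf_faithful qFG); [exact: is_hom_comp | exact: is_hom0 |].
  rewrite cfmor_comp // cf_zero -ek -comp_lfunA.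
  rewrite (_ : (_ \o cfmor F g)%VF = 0) ?comp_lfun0r //.
  apply/lfunP => x; rewrite comp_lfunE zero_lfunE; apply/eqP.
  by rewrite -memv_ker quo_proj_ker memv_img ?memvf.
exact: comp_mono_eq0 kg gk0.
Qed.

Lemma cf_ses X Y Z (f : 'Hom(X, Y)) (g : 'Hom(Y, Z)) :
  ses f g -> ses (cfmor F g) (cfmor F f).
Proof.
move=> [hf hg inj_f ex sur_g]; have hFf : is_hom (cfmor F f) := cfmor_hom hf.
have hFg : is_hom (cfmor F g) := cfmor_hom hg.
split=> //; [exact: cf_mono | | exact: cf_epi].
have gf0 : (g \o f)%VF = 0.
  apply/lfunP => x; rewrite comp_lfunE zero_lfunE; apply/eqP.
  by rewrite -memv_ker -ex memv_img ?memvf.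
apply/eqP; rewrite eqEsubv; apply/andP; split.
  apply/subvP => _ /memv_imgP[x _ ->]; rewrite memv_ker -comp_lfunE.
  by rewrite -cfmor_comp // gf0 cf_zero lfunE.
have hi := subm_incl_hom (ker_subm hFf).
have [k [e [hk he be ke]]] := cf_hom_into hi.
have kf0 : (k \o f)%VF = 0.
  apply: (cf_faithful qFG); [exact: is_hom_comp | exact: is_hom0 |].
  rewrite cfmor_comp // cf_zero; apply: (comp_bij0 be).
  rewrite -comp_lfunA ke; apply/lfunP => x; apply/eqP.
  by rewrite comp_lfunE zero_lfunE -memv_ker; exact: (subm_incl_mem x).
have [|k' hk' k'g] := factor_epi hg sur_g hk.
  rewrite -ex; apply/subvP => _ /memv_imgP[x _ ->].
  by rewrite memv_ker -comp_lfunE kf0 lfunE.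
apply/subvP => x; rewrite -[lker _](subm_incl_img (ker_subm hFf)) -ke -k'g.
rewrite cfmor_comp // => /memv_imgP[y _ ->]; rewrite !comp_lfunE.
by rewrite memv_img ?memvf.
Qed.

Lemma cf_additive phi : ses_additive phi -> ses_additive (fun M => phi (F M)).
Proof. by move=> add_phi X Y Z f g /cf_ses/add_phi->; rewrite addnC. Qed.

End Duality.

Section DualityHomDim.
Variables F G : cofunctor A.
Hypotheses (qFG : quasi_inverse F G) (qGF : quasi_inverse G F).

(** Up to the isomorphisms [eps], an extension problem into [F P] is the image
    under [F] of a lifting problem out of [P]. *)
Lemma cf_injective P : projective_mod P -> injective_mod (F P).
Proof.
move=> projP M N f g hf kf hg; have [eps [eps_iso eps_nat]] := qGF.
have [heM beM] := eps_iso M; have [heN _] := eps_iso N.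
have [e' [he' e'e ee']] := mod_iso_inv heM beM.
have [u hu uE] := cf_full qFG qGF (is_hom_comp he' hg).
have hGf : is_hom (cfmor G f) := cfmor_hom hf.
have [v hv vE] := projP _ _ _ _ hGf (cf_epi qGF qFG hf kf) hu.
exists (cfmor F v \o eps N)%VF.
  by apply: is_hom_comp => //; exact: cfmor_hom.
rewrite -comp_lfunA -eps_nat // comp_lfunA -cfmor_comp // vE uE.
by rewrite -comp_lfunA e'e comp_lfun1r.
Qed.

Hypothesis spF : simple_preserving F.

(** Both sides are additive in [M], and [F] fixes the simple modules. *)
Lemma hdim_cf P M : projective_mod P -> hdim P (F M) = hdim P M.
Proof.
move=> projP; have hadd := hdim_projective projP.
apply: (additive_ext (cf_additive qFG qGF hadd) hadd) => S sS.
exact/hdim_iso/spF.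
Qed.

Lemma hdim_cf_quasi_inverse P M : projective_mod P -> hdim P (G M) = hdim P M.
Proof.
move=> projP; rewrite -hdim_cf //; have [eps [eps_iso _]] := qGF.
by apply/esym/hdim_iso; have [he be] := eps_iso M; exists (eps M).
Qed.

(** The monomorphism [cfmor F p] from the simple module [F L] is the socle of
    [F P]: every map from a simple module to [F P] factors through it. *)
Lemma hdim_into_cf_simple P L S : simple_mod L -> projective_cover P L ->
  simple_mod S -> hdim S (F P) = hdim S L.
Proof.
move=> sL [_ [p [hp sur_p sup_p]]] sS.
rewrite -(hdim_iso S (spF sL)).
have hFp : is_hom (cfmor F p) := cfmor_hom hp.
have kFp : lker (postcomp S (cfmor F p)) = 0%VS.
  by apply: postcomp_ker; apply: (cf_mono qFG qGF).
rewrite /hdim -[RHS](limg_dim_eq (f := postcomp S (cfmor F p))) ?kFp ?capv0 //.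
congr (\dim _); apply/vspaceP => u.
apply/idP/memv_imgP => [/homvP hu | [u' /homvP hu' ->]]; last first.
  by rewrite postcompE; exact/homvP/is_hom_comp.
have [t ht bt] := spF sS; have [t' [ht' t't tt']] := mod_iso_inv ht bt.
have [k hk kE] := cf_full qFG qGF (is_hom_comp ht hu).
have [k' hk' kE'] := cover_factor hp sur_p sup_p sS hk.
exists (cfmor F k' \o t')%VF.
  by apply/homvP/is_hom_comp => //; exact: cfmor_hom.
rewrite postcompE comp_lfunA -cfmor_comp // kE' kE -comp_lfunA tt'.
by rewrite comp_lfun1r.
Qed.

(** Since [F P] is injective, both sides are additive in [M], and it suffices to
    compare them on simple modules. *)
Lemma hdim_into_cf P L M : simple_mod L -> projective_cover P L ->
  hdim M (F P) = hdim P M.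
Proof.
move=> sL cP; have add1 := hdim_projective (proj1 cP).
have add2 := hdim_injective (cf_injective (proj1 cP)).
apply: (additive_ext add2 add1) => S sS.
have [iso | niso] := pselect (mod_iso S L).
  rewrite (additive_iso add1 iso) (additive_iso add2 iso).
  by rewrite (hdim_into_cf_simple sL cP sL) (hdim_cover cP sL).
rewrite (hdim_into_cf_simple sL cP sS) (hdim_cover cP sS).
transitivity 0%N; [|symmetry]; apply/hdim0P => f hf;
  apply: contrapT => /eqP nzf.
  exact/niso/(simple_hom_iso sS sL hf).
exact/niso/mod_iso_sym/(simple_hom_iso sL sS hf).
Qed.

(** Symmetry of the Cartan matrix, weighted by the dimensions of the endomorphism
    algebras of the simple modules.  The duality is not assumed to be linear, so
    this is not its effect on Hom spaces: [F P2] has the composition factors of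
    [P2], and it is an injective module whose socle is isomorphic to [L2]. *)
Lemma hdim_cover_sym P1 P2 L2 :
  simple_mod L2 -> projective_mod P1 -> projective_cover P2 L2 ->
  hdim P1 P2 = hdim P2 P1.
Proof.
by move=> sL2 projP1 cP2; rewrite -hdim_cf // (hdim_into_cf _ sL2 cP2).
Qed.

End DualityHomDim.
End Dual.

(** * Standard and costandard modules *)

Section Stratified.
Variables (K : fieldType) (A : falgType K) (Lam : finType).
Variables (L P I : Lam -> fdmod A) (le : rel Lam).
Hypotheses (hL : simples_list L)
  (hP : forall lam, projective_cover (P lam) (L lam))
  (hI : forall lam, injective_envelope (I lam) (L lam))
  (le_po : partial_order le).

Local Notation h nu M := (hdim (P nu) M).
Local Notation Delta := (standard P le).
Local Notation Nabla := (costandard I le).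

Let simL lam : simple_mod (L lam). Proof. by case: hL. Qed.
Let addh nu : ses_additive (hdim (P nu)).
Proof. exact/hdim_projective/(proj1 (hP nu)). Qed.

Lemma hdim_simple_neq nu mu : nu != mu -> h nu (L mu) = 0%N.
Proof.
move=> /eqP ne; apply: contrapT.
move/(hdim_cover_simple (hP nu) (simL nu) (simL mu)).
by case: hL => _ inj _ /inj/esym.
Qed.

(** A map from [P nu] to [Delta mu] lifts to [P mu], and its image there lies in
    the trace unless [nu] is below [mu]. *)
Lemma standard_le nu mu : h nu (Delta mu) != 0%N -> le nu mu.
Proof.
apply: contraNT => nle; apply/eqP/hdim0P => f hf.
have [projP _] := hP nu.
have [k hk <-] := projP _ _ _ _ (quo_proj_hom (standard_ker P le mu))
  (quo_proj_img _) hf.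
apply/lfunP => v; rewrite comp_lfunE zero_lfunE; apply/eqP.
rewrite -memv_ker quo_proj_ker.
have /traceP/(_ nu k nle hk)/subvP := subvv (standard_ker P le mu).
by apply; rewrite memv_img ?memvf.
Qed.

(** The trace is contained in the radical of [P mu]. *)
Lemma standard_top mu : h mu (Delta mu) != 0%N.
Proof.
apply/eqP => /hdim0P/(_ _ (quo_proj_hom (standard_ker P le mu))) q0.
have [_ [p [hp sur_p _]]] := hP mu.
have trp : (standard_ker P le mu <= lker p)%VS.
  apply/traceP => j f nle hf; apply/subvP => _ /memv_imgP[v _ ->].
  have [le_refl _ _] := le_po.
  have ne : j != mu by apply: contraNneq nle => ->.
  have /hdim0P/(_ _ (is_hom_comp hf hp)) pf0 := hdim_simple_neq ne.
  by rewrite memv_ker -comp_lfunE pf0 lfunE.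
apply: (simple_epi_neq0 (simL mu) sur_p); apply/lfunP => v; apply/eqP.
rewrite zero_lfunE -memv_ker (subvP trp) //.
by rewrite -(quo_proj_ker (standard_ker P le mu)) memv_ker q0 lfunE.
Qed.

(** [m mu] counts the occurrences of [Delta mu] in the filtration of [P lam] with
    top [Delta lam], the quotient by the trace. *)
Lemma standard_multiplicities lam : standardly_stratified P le ->
  exists m : Lam -> nat, [/\ forall mu, m mu != 0%N -> le lam mu, m lam = 1%N
    & forall nu, h nu (P lam) = (\sum_mu m mu * h nu (Delta mu))%N].
Proof.
move=> /(_ lam)[s fs ss].
have [m [m_le m_lam mE]] : exists m : Lam -> nat,
    [/\ forall mu, m mu != 0%N -> le lam mu, m lam = 0%N
    & forall nu, (\sum_(X <- subquotients s) h nu X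
                  = \sum_mu m mu * h nu (Delta mu))%N].
  elim: (subquotients s) ss => [_ | X Xs IH /=].
    by exists (fun _ => 0%N); split=> // nu; rewrite big_nil big1.
  case/andP=> /asboolP[mu0 [ne0 le0 iso0]] /IH[m [m_le m_lam mE]].
  exists (fun mu => m mu + (mu == mu0))%N; split=> [mu | | nu].
  - by case: (mu =P mu0) => [-> // | _]; rewrite addn0 => /m_le.
  - by rewrite m_lam eq_sym (negPf ne0).
  rewrite big_cons mE (additive_iso (addh nu) iso0) addnC.
  under [RHS]eq_bigr do rewrite mulnDl.
  rewrite big_split /=; congr addn.
  rewrite (bigD1 mu0) //= eqxx mul1n big1 ?addn0 // => mu /negPf->.
  exact: mul0n.
have [le_refl _ _] := le_po.
exists (fun mu => m mu + (mu == lam))%N; split=> [mu | | nu].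
- by case: (mu =P lam) => [-> // | _]; rewrite addn0 => /m_le.
- by rewrite m_lam eqxx.
rewrite (addh nu (ses_quo (standard_ker P le lam))).
rewrite (additive_filtration (addh nu) fs) mE.
under [RHS]eq_bigr do rewrite mulnDl.
rewrite big_split /=; congr addn.
rewrite (bigD1 lam) //= eqxx mul1n big1 ?addn0 // => mu /negPf->.
exact: mul0n.
Qed.

(** If [nu] is not below [mu], every map from [Nabla mu] to [I nu] is zero,
    because it extends to [I mu]; so [L nu] is not a composition factor. *)
Lemma costandard_le nu mu : h nu (Nabla mu) != 0%N -> le nu mu.
Proof.
apply: contraNT => nle; apply/eqP/hdim0P => f hf; apply: contrapT => nzf.
have [_ [p [hp sur_p sup_p]]] := hP nu.
have [injI [i [hi ki _]]] := hI nu.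
have kfp : (lker f <= lker p)%VS.
  have [// | fpT] := simple_ker_dichotomy (ker_subm hf) (simL nu) hp.
  case: nzf; have /= fT := sup_p (ker_subm hf) fpT.
  by apply/lfunP => v; apply/eqP; rewrite zero_lfunE -memv_ker fT memvf.
have hip := is_hom_comp hp hi.
(* The image of [f], as the quotient of [P nu] by its kernel, has a quotient
   isomorphic to [L nu], hence a nonzero map [r] to [I nu]; by injectivity [r]
   extends to [Nabla mu] and then to [I mu]. *)
pose q := quo_proj (ker_subm hf).
have hq : is_hom q := quo_proj_hom _.
have sq : limg q = fullv := quo_proj_img _.
have kq : lker q = lker f := quo_proj_ker _.
have [|f' hf' f'q] := factor_epi hq sq hf; first by rewrite kq.
have [|r hr rq] := factor_epi hq sq hip.
  rewrite kq; apply/subvP => v /(subvP kfp); rewrite !memv_ker comp_lfunE.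
  by move/eqP->; rewrite linear0.
have kf' : lker f' = 0%VS.
  apply/eqP; rewrite -subv0; apply/subvP => y.
  have /limg_fullP/(_ y)[v ->] := sq.
  by rewrite memv_ker -comp_lfunE f'q -memv_ker -kq memv_ker memv0.
have [g hg gf'] := injI _ _ _ _ hf' kf' hr.
have [g' hg' g'E] := injI _ _ _ _ (subm_incl_hom _) (subm_incl_ker _) hg.
have g0 : g = 0.
  apply/lfunP => x; rewrite -g'E comp_lfunE zero_lfunE.
  have /cotraceP := subm_incl_mem x; exact.
apply: (simple_epi_neq0 (simL nu) sur_p); apply: (comp_mono_eq0 ki).
by rewrite -rq -gf' g0 !comp_lfun0l.
Qed.

Section WithDuality.
Variables F G : cofunctor A.
Hypotheses (qFG : quasi_inverse F G) (qGF : quasi_inverse G F).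
Hypothesis spF : simple_preserving F.

(** The dual of [Nabla mu] is a quotient of [Delta mu].  This inequality makes the
    pairs coming from proper costandard modules redundant in the essential
    order. *)
Lemma costandard_hdim lam mu : (h lam (Nabla mu) <= h lam (Delta mu))%N.
Proof.
have [projP [p [hp sur_p _]]] := hP mu; have [_ [i [hi ki ess_i]]] := hI mu.
(* [F (P mu)] is injective and contains a copy of [L mu], so the inclusion of
   [L mu] extends to [I mu]; the extension is injective since [L mu] is
   essential in [I mu]. *)
have hFp : is_hom (cfmor F p) := cfmor_hom hp.
have kFp := cf_mono qFG qGF hp sur_p.
have [t [ht kt _]] := proj1 (mod_isoP _ _) (mod_iso_sym (spF (simL mu))).
have hj := is_hom_comp ht hFp.
have [phi hphi phiE] := cf_injective qFG qGF projP hi ki hj.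
have kphi : lker phi = 0%VS.
  apply: (ess_i (ker_subm hphi)); apply/eqP; rewrite -subv0; apply/subvP => x.
  rewrite memv_cap => /andP[+ /memv_imgP[v _ Ev]]; rewrite Ev memv_ker => phix.
  have: (cfmor F p \o t)%VF v == 0 by rewrite -phiE comp_lfunE.
  rewrite comp_lfunE -memv_ker kFp memv0 -memv_ker kt !memv0 => /eqP->.
  by rewrite linear0.
pose w : 'Hom(Nabla mu, F (P mu)) := (phi \o subm_incl _)%VF.
have hw : is_hom w := is_hom_comp (subm_incl_hom _) hphi.
have kw : lker w = 0%VS.
  apply/lker_trivP => x y; rewrite /w !comp_lfunE.
  move/(proj1 (lker_trivP _) kphi).
  exact: (proj1 (lker_trivP _) (subm_incl_ker _)).
(* Dually, the embedding of [Nabla mu] into [F (P mu)] becomes a surjection from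
   [P mu] to [G (Nabla mu)].  The composition factors of the latter are bounded
   by [mu], so the trace lies in the kernel. *)
have hGw : is_hom (cfmor G w) := cfmor_hom hw.
have sGw := cf_epi qGF qFG hw kw.
have [eta [eta_iso _]] := qFG; have [he be] := eta_iso (P mu).
pose k := (cfmor G w \o eta (P mu))%VF.
have hk : is_hom k := is_hom_comp he hGw.
have sk : limg k = fullv.
  apply/limg_fullP => y; have /limg_fullP/(_ y)[z ->] := sGw.
  by have [e' _ e'K] := be; exists (e' z); rewrite /k comp_lfunE e'K.
have hG nu : h nu (G (Nabla mu)) = h nu (Nabla mu).
  by apply: (hdim_cf_quasi_inverse qFG qGF spF); exact: (proj1 (hP nu)).
have [|k' hk' k'E] := factor_epi (quo_proj_hom (standard_ker P le mu))
  (quo_proj_img _) hk.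
  rewrite quo_proj_ker; apply/traceP => nu f nle hf.
  have /hdim0P/(_ _ (is_hom_comp hf hk)) kf0 : h nu (G (Nabla mu)) = 0%N.
    by rewrite hG; apply/eqP; apply: contraNT nle; exact: costandard_le.
  apply/subvP => _ /memv_imgP[v _ ->].
  by rewrite memv_ker -comp_lfunE kf0 lfunE.
rewrite -hG; apply: (additive_epi (addh lam) hk').
apply/limg_fullP => y; have /limg_fullP/(_ y)[v ->] := sk.
by exists (quo_proj (standard_ker P le mu) v); rewrite -comp_lfunE k'E.
Qed.

Lemma essential_pairP lam mu :
  essential_pair L P I le lam mu <-> h lam (Delta mu) <> 0%N.
Proof.
split=> [[/(comp_factorP _ (hP lam) (simL lam)) // |] | nz]; last first.
  by left; apply/(comp_factorP _ (hP lam)).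
case=> U _ /(comp_factorP _ (hP lam) (simL lam)) nz D0; apply: nz.
apply/eqP; rewrite -leqn0 -D0; apply: leq_trans (costandard_hdim lam mu).
exact: (additive_mono (addh lam) (subm_incl_hom U) (subm_incl_ker U)).
Qed.

End WithDuality.
End Stratified.

Theorem theorem2 (K : fieldType) (A : falgType K) (Lam : finType)
    (L P I : Lam -> fdmod A) (le1 le2 : rel Lam)
    (hL : simples_list L)
    (hP : forall lam, projective_cover (P lam) (L lam))
    (hI : forall lam, injective_envelope (I lam) (L lam))
    (hle1 : partial_order le1) (hle2 : partial_order le2)
    (hss1 : standardly_stratified P le1) (hss2 : standardly_stratified P le2)
    (hdual : exists F : cofunctor A, is_duality F /\ simple_preserving F) :
  forall lam mu : Lam,
    essential_order L P I le1 lam mu <-> essential_order L P I le2 lam mu.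
Proof.
have [F [[G [qFG qGF]] spF]] := hdual.
have [sL _ _] := hL.
have [m1 m1P] :=
  boolp.choice (fun lam => standard_multiplicities hP hle1 lam hss1).
have [m2 m2P] :=
  boolp.choice (fun lam => standard_multiplicities hP hle2 lam hss2).
have sameD : forall mu lam,
    hdim (P lam) (standard P le1 mu) = hdim (P lam) (standard P le2 mu).
  apply: (triangular_factor_unique (b := fun lam nu => hdim (P nu) (P lam))
    (m1 := m1) (m2 := m2) hle1 hle2).
  - move=> lam nu.
    exact: (hdim_cover_sym qFG qGF spF (sL lam) (proj1 (hP nu)) (hP lam)).
  - by move=> lam; have [] := m1P lam.
  - by move=> lam; have [] := m2P lam.
  - by move=> lam mu; have [+ _ _] := m1P lam; apply.
  - by move=> lam mu; have [+ _ _] := m2P lam; apply.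
  - exact: standard_top hL hP hle1.
  - exact: standard_top hL hP hle2.
  - by move=> mu nu; exact: standard_le.
  - by move=> mu nu; exact: standard_le.
  - by move=> lam nu; have [_ _ +] := m1P lam; apply.
  - by move=> lam nu; have [_ _ +] := m2P lam; apply.
have pairE x y : essential_pair L P I le1 x y <-> essential_pair L P I le2 x y.
  rewrite (essential_pairP le1 hL hP hI qFG qGF spF).
  by rewrite (essential_pairP le2 hL hP hI qFG qGF spF) sameD.
move=> lam mu; split=> ess r po sub; apply: ess => // x y /pairE; exact: sub.
Qed.
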